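(* Let $\theta$ be a $\mathbb{C}$-algebra automorphism of the algebra $V=\check{U}^{\geq 0}_{r,s}(\mathfrak{sl}_3)$. Then for $l=1,2$ one has $$\theta(K_l)=a_lK_l,\qquad \theta(E_1)=b_1K_1^{a}K_2^{b}E_1,\qquad \theta(E_2)=b_2K_1^{c}K_2^{d}E_2$$ for some $a_1,a_2,b_1,b_2\in\mathbb{C}^{\ast}$ and some $a,b,c,d\in\mathbb{Z}$ such that $b=c$ and $a+b+d=0$.
   Context: Let $r,s\in\mathbb{C}^{\ast}$ be such that $r^ms^n=1$ with $m,n\in\mathbb{Z}$ implies $m=n=0$. Cube roots $r^{1/3},s^{1/3}\in\mathbb{C}$ are fixed, and $r^{k/3}=(r^{1/3})^k$, $s^{k/3}=(s^{1/3})^k$ for $k\in\mathbb{Z}$. The algebra $V=\check{U}^{\geq 0}_{r,s}(\mathfrak{sl}_3)$ is the associative unital $\mathbb{C}$-algebra generated by $E_1,E_2,K_1^{\pm1},K_2^{\pm1}$ subject to the relations: $K_iK_i^{-1}=K_i^{-1}K_i=1$ $(i=1,2)$; $K_1K_2=K_2K_1$; $K_1E_1=r^{1/3}s^{-2/3}E_1K_1$; $K_1E_2=r^{1/3}s^{1/3}E_2K_1$; $K_2E_1=r^{-1/3}s^{-1/3}E_1K_2$; $K_2E_2=r^{2/3}s^{-1/3}E_2K_2$; $E_1^2E_2-(r+s)E_1E_2E_1+rsE_2E_1^2=0$; $E_1E_2^2-(r+s)E_2E_1E_2+rsE_2^2E_1=0$. *)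

(* Defs.v *)
From HB Require Import structures.
From mathcomp Require Import all_boot all_algebra generic_quotient ring_quotient.
From mathcomp Require Import boolp.
From mathcomp Require finmap.
From mathcomp.multinomials Require Import monalg.

Set Implicit Arguments.
Unset Strict Implicit.
Unset Printing Implicit Defensive.

Import GRing.Theory.

Local Open Scope ring_scope.
Local Open Scope quotient_scope.

Section TwoSidedIdeal.

Variables (A : nzRingType) (S : seq A).

Inductive ideal_gen : A -> Prop :=
| ideal_gen0 : ideal_gen 0
| ideal_genB x y : ideal_gen x -> ideal_gen y -> ideal_gen (x - y)
| ideal_gen_in u x v : x \in S -> ideal_gen (u * x * v).

Lemma ideal_genMl u x : ideal_gen x -> ideal_gen (u * x).
Proof.
elim=> [|y z _ Iy _ Iz|u' y v' ry].
- by rewrite mulr0; exact: ideal_gen0.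
- by rewrite mulrBr; exact: ideal_genB.
by rewrite !mulrA; exact: ideal_gen_in.
Qed.

Lemma ideal_genMr x v : ideal_gen x -> ideal_gen (x * v).
Proof.
elim=> [|y z _ Iy _ Iz|u' y v' ry].
- by rewrite mul0r; exact: ideal_gen0.
- by rewrite mulrBl; exact: ideal_genB.
by rewrite -mulrA; exact: ideal_gen_in.
Qed.

Lemma ideal_genN x : ideal_gen x -> ideal_gen (- x).
Proof. by move=> Ix; rewrite -sub0r; apply: ideal_genB => //; exact: ideal_gen0. Qed.

Definition ideal_pred : {pred A} := fun x => `[< ideal_gen x >].

Fact ideal_pred_zmod_closed : zmod_closed ideal_pred.
Proof.
split=> [|x y /asboolP Ix /asboolP Iy]; apply/asboolP; first exact: ideal_gen0.
exact: ideal_genB.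
Qed.

HB.instance Definition _ :=
  GRing.isZmodClosed.Build A ideal_pred ideal_pred_zmod_closed.

End TwoSidedIdeal.

Section AlgebraQuotient.

Variables (F : fieldType) (A : algType F) (S : seq A).

(* MathComp algebras are nontrivial rings, hence the properness argument. *)
Definition alg_quot (proper : ~ ideal_gen S 1) : Type :=
  Quotient.quot (ideal_pred S : zmodClosed A).

Variable proper : ~ ideal_gen S 1.

Local Notation Q := (alg_quot proper).

HB.instance Definition _ :=
  GRing.Zmodule.copy Q (Quotient.quot (ideal_pred S : zmodClosed A)).

(* The operations are locked to keep unification from unfolding them. *)
Definition alg_pi : A -> Q :=
  locked (\pi_(Quotient.quot (ideal_pred S : zmodClosed A))).

Definition alg_repr : Q -> A :=
  locked (@repr _ (Quotient.quot (ideal_pred S : zmodClosed A))).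

Lemma alg_reprK x : alg_pi (alg_repr x) = x.
Proof. by rewrite /alg_pi /alg_repr -!lock reprK. Qed.

Lemma alg_piP x y : alg_pi x = alg_pi y <-> ideal_gen S (x - y).
Proof.
rewrite /alg_pi -lock; split=> [/eqP|I]; first by rewrite -Quotient.idealrBE => /asboolP.
by apply/eqP; rewrite -Quotient.idealrBE; apply/asboolP.
Qed.

Lemma alg_repr_pi x : ideal_gen S (alg_repr (alg_pi x) - x).
Proof. by apply/alg_piP; rewrite alg_reprK. Qed.

Fact alg_pi_is_zmod_morphism : zmod_morphism alg_pi.
Proof.
rewrite /alg_pi -lock.
exact: (raddfB (\pi_(Quotient.quot (ideal_pred S : zmodClosed A)))).
Qed.

HB.instance Definition _ :=
  GRing.isZmodMorphism.Build A Q alg_pi alg_pi_is_zmod_morphism.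

Definition quot_one : Q := alg_pi 1.
Definition quot_mul : Q -> Q -> Q :=
  locked (fun x y => alg_pi (alg_repr x * alg_repr y)).
Definition quot_scale : F -> Q -> Q :=
  locked (fun a x => alg_pi (a *: alg_repr x)).

Lemma alg_piM x y : alg_pi (x * y) = quot_mul (alg_pi x) (alg_pi y).
Proof.
rewrite /quot_mul -lock; apply/esym/alg_piP.
have := alg_repr_pi x; have := alg_repr_pi y.
set x' := alg_repr _; set y' := alg_repr _ => Ix Iy.
have -> : y' * x' - x * y = (y' - x) * x' - x * - (x' - y).
  by rewrite mulrBl mulrN opprK mulrBr addrA subrK.
apply: ideal_genB; first exact: ideal_genMr.
exact/ideal_genMl/ideal_genN.
Qed.

Lemma alg_piZ a x : alg_pi (a *: x) = quot_scale a (alg_pi x).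
Proof.
rewrite /quot_scale -lock; apply/esym/alg_piP; rewrite -scalerBr -mulr_algl.
exact/ideal_genMl/alg_repr_pi.
Qed.

Local Ltac lift_repr :=
  repeat match goal with x : alg_quot _ |- _ =>
    rewrite -[x]alg_reprK; move: (alg_repr x) => {}x end.

Fact quot_mulA : associative quot_mul.
Proof. by move=> x y z; lift_repr; rewrite -!alg_piM mulrA. Qed.

Fact quot_mul1 : left_id quot_one quot_mul.
Proof. by move=> x; lift_repr; rewrite -alg_piM mul1r. Qed.

Fact quot_mulr1 : right_id quot_one quot_mul.
Proof. by move=> x; lift_repr; rewrite -alg_piM mulr1. Qed.

Fact quot_mulDl : left_distributive quot_mul +%R.
Proof. by move=> x y z; lift_repr; rewrite -raddfD -!alg_piM -raddfD mulrDl. Qed.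

Fact quot_mulDr : right_distributive quot_mul +%R.
Proof. by move=> x y z; lift_repr; rewrite -raddfD -!alg_piM -raddfD mulrDr. Qed.

Fact quot_one_neq0 : quot_one != 0.
Proof.
apply/eqP => e10; apply: proper.
by have := alg_piP 1 0; rewrite subr0 raddf0 => -[/(_ e10)].
Qed.

HB.instance Definition _ := GRing.Zmodule_isNzRing.Build Q
  quot_mulA quot_mul1 quot_mulr1 quot_mulDl quot_mulDr quot_one_neq0.

Fact alg_pi_is_monoid_morphism : monoid_morphism alg_pi.
Proof. by split=> // x y; rewrite alg_piM. Qed.

HB.instance Definition _ :=
  GRing.isMonoidMorphism.Build A Q alg_pi alg_pi_is_monoid_morphism.

Fact quot_scaleA a b (x : Q) : quot_scale a (quot_scale b x) = quot_scale (a * b) x.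
Proof. by lift_repr; rewrite -!alg_piZ scalerA. Qed.

Fact quot_scale1 : left_id 1 quot_scale.
Proof. by move=> x; lift_repr; rewrite -alg_piZ scale1r. Qed.

Fact quot_scaleDr : right_distributive quot_scale +%R.
Proof.
by move=> a x y; lift_repr; rewrite -raddfD -!alg_piZ -raddfD scalerDr.
Qed.

Fact quot_scaleDl (x : Q) : {morph quot_scale^~ x : a b / a + b}.
Proof. by move=> a b; lift_repr; rewrite -!alg_piZ -raddfD scalerDl. Qed.

HB.instance Definition _ := GRing.Zmodule_isLmodule.Build F Q
  quot_scaleA quot_scale1 quot_scaleDr quot_scaleDl.

Fact alg_pi_is_scalable : scalable alg_pi.
Proof. by move=> a x; rewrite alg_piZ. Qed.

HB.instance Definition _ :=
  GRing.isScalable.Build F A Q *:%R alg_pi alg_pi_is_scalable.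

Let piM x y : alg_pi x * alg_pi y = alg_pi (x * y).
Proof. by rewrite alg_piM. Qed.

Let piZ a x : a *: alg_pi x = alg_pi (a *: x).
Proof. by rewrite alg_piZ. Qed.

Fact quot_scaleAl (a : F) (x y : Q) : a *: (x * y) = a *: x * y.
Proof. by lift_repr; rewrite piM !piZ piM scalerAl. Qed.

HB.instance Definition _ := GRing.Lmodule_isLalgebra.Build F Q quot_scaleAl.

Fact quot_scaleAr (a : F) (x y : Q) : a *: (x * y) = x * (a *: y).
Proof. by lift_repr; rewrite piM !piZ piM scalerAr. Qed.

HB.instance Definition _ := GRing.Lalgebra_isAlgebra.Build F Q quot_scaleAr.

(* Two-sided invertibility is decided classically, so that x^-1 and x ^ n
   (n : int) have their usual meaning for invertible x. *)
Definition is_inv (x y : Q) : Prop := y * x = 1 /\ x * y = 1.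

Definition quot_unit : pred Q := fun x => `[< exists y, is_inv x y >].

Definition quot_inv : Q -> Q := locked (fun x =>
  if pselect (exists y, is_inv x y) is left ex then projT1 (cid ex) else x).

Fact quot_mulVr : {in quot_unit, left_inverse 1 quot_inv *%R}.
Proof.
move=> x /asboolP ex; rewrite /quot_inv -lock; case: pselect => // ex'.
by case: cid => y [].
Qed.

Fact quot_divrr : {in quot_unit, right_inverse 1 quot_inv *%R}.
Proof.
move=> x /asboolP ex; rewrite /quot_inv -lock; case: pselect => // ex'.
by case: cid => y [].
Qed.

Fact quot_unitrP x y : y * x = 1 /\ x * y = 1 -> quot_unit x.
Proof. by move=> h; apply/asboolP; exists y. Qed.

Fact quot_invr_out : {in [predC quot_unit], quot_inv =1 id}.
Proof.
move=> x /negP nx; rewrite /quot_inv -lock; case: pselect => // ex.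
by case: nx; apply/asboolP.
Qed.

HB.instance Definition _ := GRing.NzRing_hasMulInverse.Build Q
  quot_mulVr quot_divrr quot_unitrP quot_invr_out.

End AlgebraQuotient.

Section FreeAlgebra.

Variables (F : fieldType) (X : choiceType).

Definition free_alg : Type := {malg F[{fmonom X}]}.

HB.instance Definition _ := GRing.Lalgebra.on free_alg.

Fact free_scaleAr (a : F) (x y : free_alg) : a *: (x * y) = x * (a *: y).
Proof.
rewrite (malgMEw (finmap.fsubset_refl (msupp x)) (msuppZ_le a y)).
rewrite malgME scaler_sumr; apply: eq_bigr => k1 _.
rewrite scaler_sumr; apply: eq_bigr => k2 _.
by apply/malgP => k; rewrite mcoeffZ !mcoeffU mcoeffZ mulrnAr mulrCA.
Qed.

HB.instance Definition _ := GRing.Lalgebra_isAlgebra.Build F free_alg free_scaleAr.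

Definition gvar (x : X) : free_alg := << 1 *g fmu x >>.

Section Lift.

Variables (W : algType F) (h : X -> W).

Definition word_eval (m : {fmonom X}) : W := \prod_(x <- m) h x.

Fact word_eval_mmorphism : mmorphism word_eval.
Proof.
split=> [m1 m2|]; first by rewrite /word_eval fmM big_cat.
by rewrite /word_eval fm1 big_nil.
Qed.

HB.instance Definition _ :=
  monalg.isMultiplicative.Build {fmonom X} W word_eval word_eval_mmorphism.

Definition free_lift : free_alg -> W := mmap (in_alg W) word_eval.

Fact free_lift_is_zmod_morphism : zmod_morphism free_lift.
Proof. exact: mmapB. Qed.

HB.instance Definition _ :=
  GRing.isZmodMorphism.Build free_alg W free_lift free_lift_is_zmod_morphism.

Fact free_lift_is_monoid_morphism : monoid_morphism free_lift.
Proof.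
have commA (g : {malg F[{fmonom X}]}) (m m' : {fmonom X}) : GRing.comm (in_alg W (mcoeff m g)) (word_eval m').
  by rewrite /GRing.comm /= mulr_algl mulr_algr.
by have [fM f1] := commr_mmap_is_multiplicative (f := in_alg W) (h := word_eval) commA; split.
Qed.

HB.instance Definition _ :=
  GRing.isMonoidMorphism.Build free_alg W free_lift free_lift_is_monoid_morphism.

Fact free_lift_is_scalable : scalable free_lift.
Proof. by move=> a x; rewrite /free_lift mmapZ /= mulr_algl. Qed.

HB.instance Definition _ :=
  GRing.isScalable.Build F free_alg W *:%R free_lift free_lift_is_scalable.

Lemma free_lift_gvar x : free_lift (gvar x) = h x.
Proof.
by rewrite /free_lift /gvar mmapU /= scale1r mul1r /word_eval fmU big_seq1.
Qed.

End Lift.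

End FreeAlgebra.

Lemma ideal_gen_morph0 (A B : nzRingType) (f : {rmorphism A -> B}) (S : seq A) x :
  {in S, forall y, f y = 0} -> ideal_gen S x -> f x = 0.
Proof.
move=> fS; elim=> [|y z _ fy _ fz|u y v Sy]; first exact: rmorph0.
  by rewrite rmorphB fy fz subrr.
by rewrite !rmorphM (fS y Sy) mulr0 mul0r.
Qed.

Inductive gen := gE1 | gE2 | gK1 | gK1V | gK2 | gK2V.

Definition gen_code (g : gen) : nat :=
  match g with gE1 => 0 | gE2 => 1 | gK1 => 2 | gK1V => 3 | gK2 => 4 | gK2V => 5 end.

Definition gen_decode : nat -> gen := nth gE1 [:: gE1; gE2; gK1; gK1V; gK2; gK2V].

Lemma gen_codeK : cancel gen_code gen_decode.
Proof. by case. Qed.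

HB.instance Definition _ := Choice.copy gen (can_type gen_codeK).

Section Presentation.

(* r3 and s3 stand for the chosen cube roots r^(1/3) and s^(1/3). *)
Variables (F : fieldType) (r s r3 s3 : F).

(* A relation u = v is recorded as the relator u - v. *)
Definition relators (A : algType F) (x : gen -> A) : seq A :=
  let E1 := x gE1 in let E2 := x gE2 in
  let K1 := x gK1 in let K1V := x gK1V in
  let K2 := x gK2 in let K2V := x gK2V in
  [:: K1 * K1V - 1; K1V * K1 - 1; K2 * K2V - 1; K2V * K2 - 1;
      K1 * K2 - K2 * K1;
      K1 * E1 - (r3 * s3 ^- 2) *: (E1 * K1);
      K1 * E2 - (r3 * s3) *: (E2 * K1);
      K2 * E1 - (r3^-1 * s3^-1) *: (E1 * K2);
      K2 * E2 - (r3 ^+ 2 * s3^-1) *: (E2 * K2);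
      E1 ^+ 2 * E2 - (r + s) *: (E1 * E2 * E1) + (r * s) *: (E2 * E1 ^+ 2);
      E1 * E2 ^+ 2 - (r + s) *: (E2 * E1 * E2) + (r * s) *: (E2 ^+ 2 * E1)].

Lemma map_relators (A B : algType F) (f : {lrmorphism A -> B}) (x : gen -> A) :
  map f (relators x) = relators (f \o x).
Proof.
rewrite /relators [LHS]/=.
have fZ a u : f (a *: u) = a *: f u by exact: linearZ.
have fD u v : f (u + v) = f u + f v by exact: rmorphD.
have fN u : f (- u) = - f u by exact: rmorphN.
have fM u v : f (u * v) = f u * f v by exact: rmorphM.
have fX u n : f (u ^+ n) = f u ^+ n by exact: rmorphXn.
have f1 : f 1 = 1 by exact: rmorph1.
by rewrite !(fD, fN, fZ, fM, fX, f1).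
Qed.

(* The counit E_i |-> 0, K_i |-> 1 kills the relators but not 1. *)
Definition counit (g : gen) : F^o := match g with gE1 | gE2 => 0 | _ => 1 end.

Lemma relators_counit : all (pred1 0) (relators counit).
Proof.
by rewrite /= !expr0n /= !mulr0 !mul0r !mulr1 !scaler0 !subrr !addr0 !eqxx.
Qed.

Fact relators_proper : ~ ideal_gen (relators (@gvar F gen)) 1.
Proof.
pose f : {lrmorphism free_alg F gen -> F^o} := free_lift counit.
have fv : f \o @gvar F gen = counit by apply/funext => g; exact: free_lift_gvar.
move=> /(ideal_gen_morph0 (f := f)) f1.
suff /f1/eqP : {in relators (@gvar F gen), forall y, f y = 0}.
  by rewrite rmorph1 oner_eq0.
move=> y /(map_f f); rewrite map_relators fv.
by move/(allP relators_counit)/eqP.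
Qed.

Definition Uge0 : Type := alg_quot relators_proper.

HB.instance Definition _ := GRing.UnitAlgebra.on Uge0.

Definition Ugen (g : gen) : Uge0 := alg_pi relators_proper (gvar F g).

Definition UE1 : Uge0 := Ugen gE1.
Definition UE2 : Uge0 := Ugen gE2.
Definition UK1 : Uge0 := Ugen gK1.
Definition UK2 : Uge0 := Ugen gK2.

Let mulK g h : gvar F g * gvar F h - 1 \in relators (@gvar F gen) -> Ugen g * Ugen h = 1.
Proof.
move=> gh; rewrite -rmorphM -(rmorph1 (alg_pi relators_proper)); apply/alg_piP.
by rewrite -[_ - 1]mul1r -[1 * _]mulr1; apply: ideal_gen_in.
Qed.

Let K1K1V : UK1 * Ugen gK1V = 1.
Proof. exact/mulK/(@mem_nth _ 0 (relators (@gvar F gen)) 0). Qed.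

Let K1VK1 : Ugen gK1V * UK1 = 1.
Proof. exact/mulK/(@mem_nth _ 0 (relators (@gvar F gen)) 1). Qed.

Let K2K2V : UK2 * Ugen gK2V = 1.
Proof. exact/mulK/(@mem_nth _ 0 (relators (@gvar F gen)) 2). Qed.

Let K2VK2 : Ugen gK2V * UK2 = 1.
Proof. exact/mulK/(@mem_nth _ 0 (relators (@gvar F gen)) 3). Qed.

Lemma UK1_unit : UK1 \is a GRing.unit.
Proof. apply/unitrP; exists (Ugen gK1V); exact (conj K1VK1 K1K1V). Qed.

Lemma UK2_unit : UK2 \is a GRing.unit.
Proof. apply/unitrP; exists (Ugen gK2V); exact (conj K2VK2 K2K2V). Qed.

Lemma UK1V : UK1^-1 = Ugen gK1V.
Proof. by apply: (mulrI UK1_unit); rewrite (mulrV UK1_unit) K1K1V. Qed.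

Lemma UK2V : UK2^-1 = Ugen gK2V.
Proof. by apply: (mulrI UK2_unit); rewrite (mulrV UK2_unit) K2K2V. Qed.

End Presentation.

(* Main.v *)
Require Import Defs.
From HB Require Import structures.
From mathcomp Require Import all_boot all_order all_algebra.
From mathcomp Require Import reals complex.
From mathcomp Require Import ring zify.
From mathcomp Require Import boolp finmap.
From mathcomp.multinomials Require Import monalg.

Set Implicit Arguments.
Unset Strict Implicit.
Unset Printing Implicit Defensive.

Import Order.TTheory GRing.Theory Num.Theory.

Local Open Scope ring_scope.

(** The algebra V is embedded into a quantum torus, where leading monomials
    multiply; this turns every question about V into one about exponents.

    Write p, q for the cube roots of r, s, and E3 = E1 E2 - s E2 E1.  The Serre
    relations say exactly that E1 E3 = r E3 E1 and E3 E2 = r E2 E3, so the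
    monomials K1^i K2^j E2^c E3^d E1^e span V [pbw_span].  Let A, A', B be
    variables with A B = s B A, A' B = r B A', A A' = (r/s) A' A, on which K1, K2
    act by the weights of E1, E1, E2.  Then E1 |-> A + A', E2 |-> B respects the
    relations [serre_skew] and sends E3 to (r - s) B A'.  In a lexicographic
    order in which A dominates, the image of K1^i K2^j E2^c E3^d E1^e has leading
    monomial K1^i K2^j B^(c+d) A'^d A^e.  These are pairwise distinct, so the
    spanning family is a basis, the map is injective, V has no zero divisors,
    and, comparing leading monomials for the order and for its opposite, every
    invertible element of V is a scalar multiple of some K1^i K2^j
    [Uge0_right_inverse].

    Let theta be an automorphism.  Then theta K1 and theta K2 are scalar
    multiples of monomials in K1, K2.  Conjugation by such a monomial multiplies
    a basis element of degree (m, n) in (E1, E2) by some p^x q^y with x, y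
    bilinear in the exponents.  Because p and q are multiplicatively
    independent, every basis element occurring in theta E1 or theta E2
    satisfies integer equations, whose only solution with degrees in N^2 is the
    identity [weight_rigidity].  Hence theta K_l = a_l K_l and
    theta E_l = f_l E_l with f_l a Laurent polynomial in K1, K2
    [theta_diagonal].  The same holds for the inverse of theta, which makes f_l
    invertible, hence a monomial.  Finally, the image of the first Serre
    relation under theta holds only if K1^c K2^d on E1 and K1^a K2^b on E2 have
    the same weight, that is b = c and a + b + d = 0 [theta_serre]. *)

(** * Positive cones *)

(** A translation-invariant total order, given by its strictly positive
    elements: y < x means that x - y lies in the cone. *)
Record pos_cone (G : zmodType) (P : pred G) : Prop := PosCone {
  cone0 : P 0 = false;
  coneD : forall x y, P x -> P y -> P (x + y);
  cone_total : forall x, x != 0 -> P x || P (- x) }.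

Definition opp_cone (G : zmodType) (P : pred G) : pred G := fun x => P (- x).

Definition lex_cone (G H : zmodType) (P : pred G) (Q : pred H) : pred (G * H) :=
  fun x => P x.1 || (x.1 == 0) && Q x.2.

Lemma pos_cone_opp (G : zmodType) (P : pred G) :
  pos_cone P -> pos_cone (opp_cone P).
Proof.
case=> P0 PD Pt; split=> [|x y|x x0]; rewrite /opp_cone ?oppr0 //.
  by rewrite opprD; exact: PD.
by rewrite opprK orbC; exact: Pt.
Qed.

Lemma pos_cone_lex (G H : zmodType) (P : pred G) (Q : pred H) :
  pos_cone P -> pos_cone Q -> pos_cone (lex_cone P Q).
Proof.
case=> P0 PD Pt [Q0 QD Qt]; split=> [|[x1 x2] [y1 y2]|[x1 x2]];
  rewrite /lex_cone /=.
- by rewrite P0 Q0 andbF.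
- case/orP=> [Px1|/andP[/eqP-> Qx2]] /orP[Py1|/andP[/eqP-> Qy2]].
  + by rewrite PD.
  + by rewrite addr0 Px1.
  + by rewrite add0r Py1.
  + by rewrite addr0 eqxx QD ?orbT.
have [->|x1n0] := eqVneq x1 0.
  rewrite P0 oppr0 P0 eqxx /= => x20; apply: Qt; apply: contraNneq x20 => ->; exact: eqxx.
by move=> _; case/orP: (Pt _ x1n0) => ->; rewrite ?orbT.
Qed.

Lemma pos_cone_int : pos_cone (fun x : int => 0 < x).
Proof.
split=> [|x y|x x0]; first exact: ltxx; first exact: addr_gt0.
by rewrite oppr_gt0; case: ltgtP x0.
Qed.

(** * Twisted group algebras *)

Section TwistedGroupAlgebra.

Variables (F : fieldType) (G : zmodType).

Record bicharacter (b : G -> G -> F) : Prop := Bicharacter {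
  bicharDl : forall x y z, b (x + y) z = b x z * b y z;
  bicharDr : forall x y z, b x (y + z) = b x y * b x z;
  bichar_neq0 : forall x y, b x y != 0 }.

Variables (b : G -> G -> F) (hb : bicharacter b).

Lemma bichar0l x : b 0 x = 1.
Proof.
by apply: (mulfI (bichar_neq0 hb 0 x)); rewrite -(bicharDl hb) addr0 mulr1.
Qed.

Lemma bichar0r x : b x 0 = 1.
Proof.
by apply: (mulfI (bichar_neq0 hb x 0)); rewrite -(bicharDr hb) addr0 mulr1.
Qed.

(** The quantum torus when G = Z^n: the free module on G, with the product
    X_d X_e = b d e X_(d + e). *)
Definition twisted of bicharacter b : Type := {malg F[G]}.

Local Notation T := (twisted hb).

HB.instance Definition _ := GRing.Lmodule.on T.

(** Opaque, so that comparing two distinct monomials during unification does not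
    unfold them to finitely supported functions. *)
Fact tmon_sealed : {f : G -> T | forall d, f d = << 1 *g d >>}.
Proof. by exists (fun d => << 1 *g d >>). Qed.

Definition tmon : G -> T := sval tmon_sealed.

Lemma tmonE d : tmon d = << 1 *g d >>.
Proof. exact: (svalP tmon_sealed). Qed.

Definition tone : T := tmon 0.

(* Locked, since lemmas on big sums would otherwise see through it. *)
Definition tmul : T -> T -> T := locked (fun x y =>
  \sum_(d <- msupp x) \sum_(e <- msupp y) << b d e * (x@_d * y@_e) *g d + e >>).

Lemma tmulw (D E : {fset G}) (x y : T) : (msupp x `<=` D)%fset -> (msupp y `<=` E)%fset ->
  tmul x y = \sum_(d <- D) \sum_(e <- E) << b d e * (x@_d * y@_e) *g d + e >>.
Proof.
move=> xD yE; rewrite /tmul -lock (big_fset_incl _ xD) /= => [|d _ /mcoeff_outdom xd].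
  apply: eq_bigr => d _; apply: big_fset_incl => // e _ /mcoeff_outdom ye.
  by rewrite ye !mulr0 monalgU0.
by rewrite big1 // => e _; rewrite xd mul0r mulr0 monalgU0.
Qed.

Lemma tmulDl : left_distributive tmul +%R.
Proof.
move=> x y z; have zz := fsubset_refl (msupp z).
rewrite (tmulw (msuppD_le x y) zz) (tmulw (fsubsetUl _ (msupp y)) zz).
rewrite (tmulw (fsubsetUr (msupp x) _) zz) -big_split; apply: eq_bigr => d _.
rewrite -big_split; apply: eq_bigr => e _.
by rewrite mcoeffD mulrDl mulrDr monalgUD.
Qed.

Lemma tmulDr : right_distributive tmul +%R.
Proof.
move=> z x y; have zz := fsubset_refl (msupp z).
rewrite (tmulw zz (msuppD_le x y)) (tmulw zz (fsubsetUl _ (msupp y))).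
rewrite (tmulw zz (fsubsetUr (msupp x) _)) -big_split; apply: eq_bigr => d _.
rewrite -big_split; apply: eq_bigr => e _.
by rewrite mcoeffD !mulrDr monalgUD.
Qed.

Lemma tmulUU (c c' : F) d e :
  tmul << c *g d >> << c' *g e >> = << b d e * (c * c') *g d + e >>.
Proof. by rewrite (tmulw msuppU_le msuppU_le) !big_seq_fset1 !mcoeffUU. Qed.

Lemma tmul0l x : tmul 0 x = 0.
Proof. by rewrite /tmul -lock msupp0 big_seq_fset0. Qed.

Lemma tmul0r x : tmul x 0 = 0.
Proof. by rewrite /tmul -lock big1 // => d _; rewrite msupp0 big_seq_fset0. Qed.

Lemma tmul_suml I (s : seq I) (f : I -> T) y :
  tmul (\sum_(i <- s) f i) y = \sum_(i <- s) tmul (f i) y.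
Proof.
exact: (big_morph (tmul^~ y) (fun x x' => tmulDl x x' y) (tmul0l y)).
Qed.

Lemma tmul_sumr I (s : seq I) x (f : I -> T) :
  tmul x (\sum_(i <- s) f i) = \sum_(i <- s) tmul x (f i).
Proof. exact: (big_morph (tmul x) (tmulDr x) (tmul0r x)). Qed.

Lemma tmulA : associative tmul.
Proof.
move=> x y z; rewrite [x]monalgE !tmul_suml; apply: eq_bigr => d _.
rewrite [y]monalgE tmul_suml !tmul_sumr tmul_suml; apply: eq_bigr => e _.
rewrite [z]monalgE !tmul_sumr; apply: eq_bigr => f _.
rewrite !tmulUU addrA; congr << _ *g _ >>.
by rewrite (bicharDl hb) (bicharDr hb); ring.
Qed.

Lemma tmul1l : left_id tone tmul.
Proof.
move=> x; rewrite [x]monalgE tmul_sumr; apply: eq_bigr => d _.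
by rewrite /tone tmonE tmulUU add0r bichar0l !mul1r.
Qed.

Lemma tmul1r : right_id tone tmul.
Proof.
move=> x; rewrite [x]monalgE tmul_suml; apply: eq_bigr => d _.
by rewrite /tone tmonE tmulUU addr0 bichar0r mul1r mulr1.
Qed.

Lemma tone_neq0 : tone != 0.
Proof. by rewrite /tone tmonE monalgU_eq0 oner_eq0. Qed.

HB.instance Definition _ := GRing.Zmodule_isNzRing.Build T
  tmulA tmul1l tmul1r tmulDl tmulDr tone_neq0.

Lemma tscaleU (c a : F) d : c *: (<< a *g d >> : T) = << c * a *g d >>.
Proof. by apply/malgP => e; rewrite mcoeffZ !mcoeffU mulrnAr. Qed.

Fact tscaleAl (c : F) (x y : T) : c *: (x * y) = c *: x * y.
Proof.
rewrite -![_ * y]/(tmul _ y) [x]monalgE scaler_sumr !tmul_suml scaler_sumr.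
apply: eq_bigr => d _; rewrite [y]monalgE !tmul_sumr scaler_sumr.
apply: eq_bigr => e _; rewrite tscaleU !tmulUU tscaleU; congr << _ *g _ >>.
by ring.
Qed.

HB.instance Definition _ := GRing.Lmodule_isLalgebra.Build F T tscaleAl.

Fact tscaleAr (c : F) (x y : T) : c *: (x * y) = x * (c *: y).
Proof.
rewrite -![x * _]/(tmul x _) [x]monalgE !tmul_suml scaler_sumr.
apply: eq_bigr => d _; rewrite [y]monalgE scaler_sumr !tmul_sumr scaler_sumr.
apply: eq_bigr => e _; rewrite tscaleU !tmulUU tscaleU; congr << _ *g _ >>.
by ring.
Qed.

HB.instance Definition _ := GRing.Lalgebra_isAlgebra.Build F T tscaleAr.

Lemma tmonM d e : tmon d * tmon e = b d e *: tmon (d + e).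
Proof. by rewrite -[LHS]/(tmul _ _) !tmonE tmulUU tscaleU mulr1. Qed.

Lemma tmonC c d e : b d e = c * b e d -> tmon d * tmon e = c *: (tmon e * tmon d).
Proof. by move=> de; rewrite !tmonM de scalerA [e + d]addrC. Qed.

Lemma mcoeff_tmul (x y : T) g : (x * y)@_g =
  \sum_(d <- msupp x) \sum_(e <- msupp y) (b d e * (x@_d * y@_e)) *+ (d + e == g).
Proof.
rewrite -[x * y]/(tmul x y) /tmul -lock raddf_sum; apply: eq_bigr => d _.
by rewrite raddf_sum; apply: eq_bigr => e _; rewrite /= mcoeffU.
Qed.

Lemma mcoeff_tmon d e : (tmon d)@_e = (d == e)%:R.
Proof. by rewrite tmonE mcoeffU. Qed.

(** The monomial d occurs in x and dominates every other monomial of x, for the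
    order with positive cone P. *)
Definition lead (P : pred G) (x : T) (d : G) : Prop :=
  x@_d != 0 /\ forall e, x@_e != 0 -> e = d \/ P (d - e).

Lemma lead_tmon P d : lead P (tmon d) d.
Proof.
split=> [|e]; rewrite mcoeff_tmon ?eqxx ?oner_eq0 //.
by case: (eqVneq d e) => [->|_]; [left | rewrite eqxx].
Qed.

Lemma leadZ P c x d : c != 0 -> lead P x d -> lead P (c *: x) d.
Proof.
move=> c0 [xd xle]; split=> [|e]; rewrite mcoeffZ mulf_eq0 negb_or ?c0 //.
by case/andP=> _; exact: xle.
Qed.

Section Cone.

Variables (P : pred G) (hP : pos_cone P).

Lemma lead_neq0 x d : lead P x d -> x != 0.
Proof. by case=> + _; apply: contraNneq => ->; rewrite mcoeff0. Qed.

Lemma lead_uniq x d e : lead P x d -> lead P x e -> d = e.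
Proof.
case=> xd xled [xe xlee]; case: (xlee _ xd) => // Ped; case: (xled _ xe) => // Pde.
by have := coneD hP Ped Pde; rewrite addrA subrK subrr (cone0 hP).
Qed.

Lemma lead_exists x : x != 0 -> exists d, lead P x d.
Proof.
move=> x0; have: exists d, d \in (msupp x : seq G).
  apply/not_existsP => no; move/eqP: x0; apply; apply/malgP => d.
  by rewrite mcoeff0 mcoeff_outdom //; apply/negP => /no.
have: {subset (msupp x : seq G) <= msupp x} by [].
suff max (s : seq G) : {subset s <= msupp x} -> (exists d, d \in s) ->
    exists2 d, x@_d != 0 & forall e, e \in s -> e = d \/ P (d - e).
  by move=> /max h /h[d xd le]; exists d; split=> // e; rewrite mcoeff_neq0 => /le.
elim: s => [|d s IHs] sx; first by case.
move=> _; have xd : x@_d != 0 by rewrite mcoeff_neq0 sx // mem_head.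
have [->|s0] := eqVneq s [::].
  by exists d => // e; rewrite inE => /eqP; left.
case: IHs => [e es||m xm mle]; first by apply: sx; rewrite inE es orbT.
  by case: s s0 {sx} => // e s _; exists e; rewrite mem_head.
have [dm|dm] := eqVneq d m.
  by exists m => // e; rewrite inE => /predU1P[->|/mle //]; left.
have: d - m != 0 by rewrite subr_eq0.
move/(cone_total hP); rewrite opprB => /orP[] Pdm; last first.
  by exists m => // e; rewrite inE => /predU1P[->|/mle //]; right.
exists d => // e; rewrite inE => /predU1P[->|/mle[->|Pme]]; [by left|by right|right].
by rewrite -(subrK m d) -addrA; exact: coneD.
Qed.

(** If d' <= d and e' <= e then d' + e' = d + e forces d' = d and e' = e, so the
    coefficient of the product at d + e is a single nonzero term. *)
Lemma leadM x y d e : lead P x d -> lead P y e -> lead P (x * y) (d + e).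
Proof.
move=> [xd xle] [ye yle]; split; last first.
  move=> g; rewrite mcoeff_tmul => nz.
  have [d' xd' [e' ye' eqg]] : exists2 d', x@_d' != 0 &
      exists2 e', y@_e' != 0 & d' + e' = g.
    apply: contrapT => no; move/eqP: nz; apply.
    rewrite big_seq big1 // => d' /= xd'; rewrite big_seq big1 // => e' /= ye'.
    case: eqP => // eqg; case: no; exists d'; first by rewrite mcoeff_neq0.
    by exists e'; rewrite ?mcoeff_neq0.
  rewrite -eqg opprD addrACA.
  case: (xle _ xd') (yle _ ye') => [->|Pd] [->|Pe]; first by left.
  + by right; rewrite subrr add0r.
  + by right; rewrite subrr addr0.
  by right; exact: coneD.
rewrite mcoeff_tmul (big_fsetD1 d) -?mcoeff_neq0 //=.
rewrite (big_fsetD1 e) -?mcoeff_neq0 //= eqxx mulr1n.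
rewrite [X in _ + X + _]big_seq big1 => [|e']; last first.
  rewrite in_fsetD1 => /andP[/negbTE ne _].
  by rewrite (inj_eq (addrI d)) ne.
rewrite [X in _ + _ + X]big_seq big1 => [|d'].
  by rewrite !addr0 !mulf_neq0 // (bichar_neq0 hb).
rewrite in_fsetD1 -mcoeff_neq0 => /andP[nd xd'].
rewrite big_seq big1 // => e'; rewrite -mcoeff_neq0 => ye'.
case: eqP => // eqs; exfalso.
case: (xle _ xd') => [dd|Pd]; first by rewrite dd eqxx in nd.
have De : e' - e = d - d' by apply/eqP; rewrite subr_eq addrAC -eqs addrC addKr.
case: (yle _ ye') => [ee|Pe].
  by rewrite ee subrr in De; rewrite -De (cone0 hP) in Pd.
by have := coneD hP Pd Pe; rewrite -De addrA subrK subrr (cone0 hP).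
Qed.

Lemma lead1 : lead P 1 0.
Proof. exact: lead_tmon. Qed.

Lemma leadX x d n : lead P x d -> lead P (x ^+ n) (d *+ n).
Proof.
move=> xd; elim: n => [|n IHn]; first by rewrite expr0 mulr0n; exact: lead1.
by rewrite exprS mulrS; exact: leadM.
Qed.

(** A family whose leading exponents are pairwise distinct is linearly
    independent: in a combination, the largest of these exponents survives. *)
Lemma lead_lincomb (I : choiceType) (y : {malg F[I]}) (f : I -> T) (l : I -> G) :
  injective l -> (forall k, lead P (f k) (l k)) -> y != 0 ->
  exists k, lead P (\sum_(i <- msupp y) y@_i *: f i) (l k).
Proof.
move=> linj fl y0.
(* A stand-in for y with exponents moved to G, whose lead locates the maximum. *)
pose z : T := \sum_(i <- msupp y) y@_i *: tmon (l i).
have zE k : z@_(l k) = y@_k.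
  rewrite raddf_sum [y in RHS]monalgE raddf_sum; apply: eq_bigr => i _ /=.
  by rewrite mcoeffZ mcoeff_tmon mcoeffU (inj_eq linj) mulr_natr.
have zsupp d : z@_d != 0 -> exists2 k, y@_k != 0 & d = l k.
  move=> zd; apply: contrapT => no; move/eqP: zd; apply.
  rewrite raddf_sum big_seq big1 // => i yi /=.
  rewrite mcoeffZ mcoeff_tmon; case: eqP => [eqd|]; last by rewrite mulr0.
  by case: no; exists i; rewrite ?mcoeff_neq0.
have /lead_exists[d [zd zle]] : z != 0.
  apply: contraNneq y0 => z0; apply/eqP/malgP => k.
  by rewrite -zE z0 !mcoeff0.
have [k yk dE] := zsupp d zd; exists k.
have le i : y@_i != 0 -> l i = l k \/ P (l k - l i).
  by rewrite -zE -dE => /zle.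
split.
  rewrite raddf_sum (big_fsetD1 k) -?mcoeff_neq0 //= [X in _ + X]big_seq big1.
    by rewrite addr0 mcoeffZ mulf_neq0 // (fl k).1.
  move=> i; rewrite in_fsetD1 -mcoeff_neq0 => /andP[ik yi].
  rewrite mcoeffZ; case: (eqVneq ((f i)@_(l k)) 0) => [->|fik]; first by rewrite mulr0.
  have [eqk|Pik] := (fl i).2 _ fik; first by rewrite (linj _ _ eqk) eqxx in ik.
  have [eqk|Pki] := le _ yi; first by rewrite (linj _ _ eqk) eqxx in ik.
  by have := coneD hP Pik Pki; rewrite addrA subrK subrr (cone0 hP).
move=> e; rewrite raddf_sum => nz.
have [i yi fie] : exists2 i, y@_i != 0 & (f i)@_e != 0.
  apply: contrapT => no; move/eqP: nz; apply; rewrite big_seq big1 // => i yi /=.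
  rewrite mcoeffZ; case: (eqVneq ((f i)@_e) 0) => [->|fie]; first by rewrite mulr0.
  by case: no; exists i => //; rewrite mcoeff_neq0.
have [->|Pe] := (fl i).2 _ fie; first exact: le.
have [<-|Pki] := le _ yi; first by right.
by right; rewrite -(subrK (l i) (l k)) -addrA; exact: coneD.
Qed.

End Cone.

Lemma lead_mono (P : pred G) x d : pos_cone P -> lead P x d -> lead (opp_cone P) x d ->
  x = x@_d *: tmon d.
Proof.
move=> hP [xd xle] [_ xge]; apply/malgP => e; rewrite mcoeffZ mcoeff_tmon.
have [->|ne] := eqVneq d e; first by rewrite mulr1.
rewrite mulr0; apply/eqP; case: eqVneq => // xe.
case: (xle _ xe) => [ed|Pd]; first by rewrite ed eqxx in ne.
case: (xge _ xe) => [ed|]; first by rewrite ed eqxx in ne.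
rewrite /opp_cone opprB => Pe.
by have := coneD hP Pd Pe; rewrite addrA subrK subrr (cone0 hP).
Qed.

(** Largest exponents of x and y add up to 0, and so do smallest ones; since
    smallest <= largest for both factors, they coincide. *)
Lemma twisted_unit (P : pred G) (x y : T) : pos_cone P -> x * y = 1 ->
  exists d, [/\ lead P x (- d), lead P y d & lead (opp_cone P) y d].
Proof.
move=> hP xy1; have hN := pos_cone_opp hP.
have x0 : x != 0 by apply: contra_eq_neq xy1 => ->; rewrite mul0r eq_sym oner_neq0.
have y0 : y != 0 by apply: contra_eq_neq xy1 => ->; rewrite mulr0 eq_sym oner_neq0.
have [d xd] := lead_exists hP x0; have [e ye] := lead_exists hP y0.
have [d' xd'] := lead_exists hN x0; have [e' ye'] := lead_exists hN y0.
have de : d + e = 0 by apply: (lead_uniq hP) (leadM hP xd ye) _; rewrite xy1; exact: lead1.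
have de' : d' + e' = 0.
  by apply: (lead_uniq hN) (leadM hN xd' ye') _; rewrite xy1; exact: lead1.
have ee : e' = e.
  case: (ye.2 _ ye'.1) => // Pe; case: (xd.2 _ xd'.1) => [dd|Pd].
    by apply: (addrI d); rewrite de -dd de'.
  have De : d - d' = - (e - e').
    by rewrite (canRL (addrK _) de) (canRL (addrK _) de') !sub0r opprK addrC opprB.
  by have := coneD hP Pd Pe; rewrite De addNr (cone0 hP).
exists e; rewrite -{1}(addr0_eq de) opprK; split=> //.
by rewrite -ee.
Qed.

End TwistedGroupAlgebra.

(** * The universal property of the presentation *)

Section QuotientLift.

Variables (F : fieldType) (A W : algType F) (S : seq A).
Variables (proper : ~ ideal_gen S 1) (f : {lrmorphism A -> W}).
Hypothesis fS : {in S, forall y, f y = 0}.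

Definition quot_lift of {in S, forall y, f y = 0} :=
  fun x : alg_quot proper => f (alg_repr x).

Local Notation g := (quot_lift fS).

Lemma quot_lift_pi x : g (alg_pi proper x) = f x.
Proof.
apply/eqP; rewrite -subr_eq0 -rmorphB; apply/eqP.
exact: (ideal_gen_morph0 fS (alg_repr_pi proper x)).
Qed.

Fact quot_lift_is_zmod_morphism : zmod_morphism g.
Proof.
move=> x y; rewrite -(alg_reprK x) -(alg_reprK y) -raddfB !quot_lift_pi.
exact: raddfB.
Qed.

HB.instance Definition _ := GRing.isZmodMorphism.Build (alg_quot proper) W g
  quot_lift_is_zmod_morphism.

Fact quot_lift_is_monoid_morphism : monoid_morphism g.
Proof.
split=> [|x y]; first by rewrite -(rmorph1 (alg_pi proper)) quot_lift_pi rmorph1.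
rewrite -(alg_reprK x) -(alg_reprK y) -rmorphM !quot_lift_pi.
exact: rmorphM.
Qed.

HB.instance Definition _ := GRing.isMonoidMorphism.Build (alg_quot proper) W g
  quot_lift_is_monoid_morphism.

Fact quot_lift_is_scalable : scalable g.
Proof.
move=> a x; rewrite -(alg_reprK x) -linearZ !quot_lift_pi; exact: linearZ.
Qed.

HB.instance Definition _ := GRing.isScalable.Build F (alg_quot proper) W *:%R g
  quot_lift_is_scalable.

End QuotientLift.

Section Presentation.

Variables (F : fieldType) (r s r3 s3 : F).

Local Notation V := (Uge0 r s r3 s3).
Local Notation gen_of := (Ugen r s r3 s3).

Lemma Uge0_lift (W : algType F) (h : gen -> W) :
  {in relators r s r3 s3 h, forall y, y = 0} ->
  exists g : {lrmorphism V -> W}, forall x, g (gen_of x) = h x.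
Proof.
move=> h0; pose f : {lrmorphism free_alg F gen -> W} := free_lift h.
have fv : f \o @gvar F gen = h by apply/funext => x; exact: free_lift_gvar.
have fS : {in relators r s r3 s3 (@gvar F gen), forall y, f y = 0}.
  by move=> y /(map_f f); rewrite map_relators fv => /h0.
exists (@quot_lift _ _ _ _ (@relators_proper F r s r3 s3) f fS) => x.
exact: (etrans (quot_lift_pi _ fS _) (free_lift_gvar _ _)).
Qed.

Lemma Ugen_relators : {in relators r s r3 s3 gen_of, forall y : V, y = 0}.
Proof.
pose f : {lrmorphism free_alg F gen -> V} := alg_pi (@relators_proper F r s r3 s3).
have -> : relators r s r3 s3 gen_of = map f (relators r s r3 s3 (@gvar F gen)).
  by rewrite map_relators.
move=> _ /mapP[y Sy ->]; rewrite -(rmorph0 f); apply/alg_piP.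
by rewrite subr0 -[y]mul1r -[_ * y]mulr1; exact: ideal_gen_in.
Qed.

Lemma Uge0_ind (P : V -> Prop) :
  P 0 -> (forall x y, P x -> P y -> P (x + y)) -> (forall c x, P x -> P (c *: x)) ->
  P 1 -> (forall g x, P x -> P (gen_of g * x)) -> forall x, P x.
Proof.
move=> P0 PD PZ P1 PM x; rewrite -(alg_reprK x); move: (alg_repr x) => {x} y.
have -> : y = \sum_(k <- msupp y) y@_k *: (<< 1 *g k >> : free_alg F gen).
  rewrite [LHS]monalgE; apply: eq_bigr => k _.
  by apply/malgP => l; rewrite mcoeffZ !mcoeffU mulrnAr mulr1.
pose f : {lrmorphism free_alg F gen -> V} := alg_pi (@relators_proper F r s r3 s3).
rewrite -[alg_pi _ _]/(f _) raddf_sum; elim/big_rec: _ => // k z _; apply: PD.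
have fZ a u : f (a *: u) = a *: f u by exact: linearZ.
rewrite [X in P X]fZ; apply: PZ.
case: k => k; elim: k => [|g k IHk].
  by rewrite -fmoneE [f _](rmorph1 f).
rewrite [X in f X](_ : _ = gvar F g * (<< 1 *g FMonom k >> : free_alg F gen)).
  by rewrite rmorphM; exact: PM.
rewrite /gvar -[RHS]/(fgmul _ _) fgmulUU mul1r; congr << _ *g _ >>.
by rewrite -[RHS](fmK) fmM fmU.
Qed.

End Presentation.

(** * Elements commuting up to a scalar *)

Definition qcomm (F : fieldType) (A : algType F) (c : F) (x y : A) : Prop :=
  x * y = c *: (y * x).

Section QComm.

Variables (F : fieldType) (A : algType F).
Implicit Types (c d : F) (x y z : A).

Lemma qcommMl c d x y z : qcomm c x z -> qcomm d y z -> qcomm (c * d) (x * y) z.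
Proof.
rewrite /qcomm => xz yz.
by rewrite -mulrA yz -scalerAr [x * (z * y)]mulrA xz -scalerAl scalerA -mulrA mulrC.
Qed.

Lemma qcommMr c d x y z : qcomm c x y -> qcomm d x z -> qcomm (c * d) x (y * z).
Proof.
rewrite /qcomm => xy xz.
by rewrite mulrA xy -scalerAl -[y * x * z]mulrA xz -scalerAr scalerA mulrA.
Qed.

Lemma qcomm1r x : qcomm 1 x 1.
Proof. by rewrite /qcomm mulr1 mul1r scale1r. Qed.

Lemma qcomm1l x : qcomm 1 1 x.
Proof. by rewrite /qcomm mulr1 mul1r scale1r. Qed.

Lemma qcommXr c x y n : qcomm c x y -> qcomm (c ^+ n) x (y ^+ n).
Proof.
move=> xy; elim: n => [|n IHn]; first by rewrite !expr0; exact: qcomm1r.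
by rewrite !exprS; exact: qcommMr.
Qed.

Lemma qcommXl c x y n : qcomm c x y -> qcomm (c ^+ n) (x ^+ n) y.
Proof.
move=> xy; elim: n => [|n IHn]; first by rewrite !expr0; exact: qcomm1l.
by rewrite !exprS; exact: qcommMl.
Qed.

Lemma qcommDr c x y z : qcomm c x y -> qcomm c x z -> qcomm c x (y + z).
Proof. by rewrite /qcomm mulrDr mulrDl scalerDr => -> ->. Qed.

Lemma qcommZr c d x y : qcomm c x y -> qcomm c x (d *: y).
Proof.
by rewrite /qcomm -scalerAr -scalerAl => ->; rewrite !scalerA mulrC.
Qed.

Lemma qcomm_sym c x y : c != 0 -> qcomm c x y -> qcomm c^-1 y x.
Proof. by rewrite /qcomm => c0 ->; rewrite scalerA mulVf // scale1r. Qed.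

Lemma qcommDl c x y z : qcomm c x z -> qcomm c y z -> qcomm c (x + y) z.
Proof. by rewrite /qcomm mulrDr mulrDl scalerDr => -> ->. Qed.

Lemma qcommZl c d x y : qcomm c x y -> qcomm c (d *: x) y.
Proof. by rewrite /qcomm -scalerAl -scalerAr => ->; rewrite !scalerA mulrC. Qed.

Lemma qcomm_refl x : qcomm 1 x x.
Proof. by rewrite /qcomm scale1r. Qed.

Lemma qcommVl c x x' y : x' * x = 1 -> x * x' = 1 -> c != 0 ->
  qcomm c x y -> qcomm c^-1 x' y.
Proof.
rewrite /qcomm => x'x xx' c0 xy.
rewrite -[x' * y]mulr1 -xx' -!mulrA [y * (_ * _)]mulrA.
have -> : y * x = c^-1 *: (x * y) by rewrite xy scalerA mulVf // scale1r.
by rewrite -scalerAl -scalerAr -[x * y * x']mulrA [x' * (x * _)]mulrA x'x mul1r.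
Qed.

(** The Serre relations say that x and y commute up to r with the skew
    commutator x y - s y x. *)
Lemma serre1E (r s : F) x y :
  x ^+ 2 * y - (r + s) *: (x * y * x) + (r * s) *: (y * x ^+ 2) =
  x * (x * y - s *: (y * x)) - r *: ((x * y - s *: (y * x)) * x).
Proof.
rewrite mulrBr mulrBl -scalerAr -scalerAl scalerBr scalerA scalerDl !expr2 !mulrA.
by rewrite !opprD opprK !addrA [_ - _ - s *: _]addrAC.
Qed.

Lemma serre2E (r s : F) x y :
  x * y ^+ 2 - (r + s) *: (y * x * y) + (r * s) *: (y ^+ 2 * x) =
  (x * y - s *: (y * x)) * y - r *: (y * (x * y - s *: (y * x))).
Proof.
rewrite mulrBr mulrBl -scalerAr -scalerAl scalerBr scalerA scalerDl !expr2 !mulrA.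
by rewrite !opprD opprK !addrA [_ - _ - s *: _]addrAC.
Qed.

Lemma skew_commutator (r s : F) x y z : qcomm s x z -> qcomm r y z ->
  (x + y) * z - s *: (z * (x + y)) = (r - s) *: (z * y).
Proof.
move=> xz yz; rewrite mulrDl mulrDr xz yz scalerDr scalerBl opprD addrACA.
by rewrite subrr add0r.
Qed.

(** The two-parameter version of the Feigin homomorphism to a quantum torus: x + y
    and z satisfy the Serre relations, because their skew commutator is
    the monomial z y. *)
Lemma serre_skew (r s : F) x y z : s != 0 ->
  qcomm s x z -> qcomm r y z -> qcomm (r / s) x y ->
  (x + y) ^+ 2 * z - (r + s) *: ((x + y) * z * (x + y))
    + (r * s) *: (z * (x + y) ^+ 2) = 0 /\
  (x + y) * z ^+ 2 - (r + s) *: (z * (x + y) * z)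
    + (r * s) *: (z ^+ 2 * (x + y)) = 0.
Proof.
move=> s0 xz yz xy; rewrite serre1E serre2E (skew_commutator xz yz).
have x_zy : qcomm r x (z * y) by rewrite -(divfK s0 r) mulrC; exact: qcommMr.
have y_zy : qcomm r y (z * y) by rewrite -[r]mulr1; exact: qcommMr yz (qcomm_refl y).
have zy_z : qcomm r (z * y) z by rewrite -[r]mul1r; exact: qcommMl (qcomm_refl z) yz.
split; apply/eqP; rewrite subr_eq0; apply/eqP.
  exact: qcommZr (qcommDl x_zy y_zy).
exact: qcommZl zy_z.
Qed.

End QComm.

Lemma qcommXzl (F : fieldType) (A : unitAlgType F) c (x y : A) (i : int) :
  x \is a GRing.unit -> c != 0 -> qcomm c x y -> qcomm (c ^ i) (x ^ i) y.
Proof.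
move=> ux c0 xy; case: i => n; first exact: qcommXl.
rewrite !NegzE -!exprnN -!exprVn; apply: qcommXl.
by apply: qcommVl xy; rewrite ?mulVr ?mulrV.
Qed.

(** * Exponents and weights *)

(** Exponents of A, A', B, K1, K2, in this order, so that A dominates in the
    lexicographic cone. *)
Definition expo : zmodType := (int * (int * (int * (int * int))))%type.

Definition expo_cone : pred expo :=
  let pos := fun x : int => 0 < x in
  lex_cone pos (lex_cone pos (lex_cone pos (lex_cone pos pos))).

Lemma expoD (a a' c i j b b' d k l : int) :
  (a, (a', (c, (i, j)))) + (b, (b', (d, (k, l)))) =
  (a + b, (a' + b', (c + d, (i + k, j + l)))) :> expo.
Proof. by []. Qed.

Lemma expoMn (a a' c i j : int) n :
  (a, (a', (c, (i, j)))) *+ n = (a *+ n, (a' *+ n, (c *+ n, (i *+ n, j *+ n)))) :> expo.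
Proof. by elim: n => [|n IHn]; rewrite ?mulr0n // !mulrS IHn. Qed.

Lemma pos_cone_expo : pos_cone expo_cone.
Proof. by do !apply: pos_cone_lex; exact: pos_cone_int. Qed.

(** The hypotheses state that the monomial K1^i K2^j has on the degrees (m, n) and
    (m', n') the weights that K1 has on E1 and E2.  For a suitable identification of
    Z^2 with Z[w], w a cube root of unity, they say that the degrees are the
    images of (1, 0) and (0, 1) under multiplication by one of the six units;
    only the identity keeps both of them in N^2. *)
Lemma weight_rigidity (i j : int) (m n m' n' : nat) :
  i * (m%:Z + n%:Z) + j * (2 * n%:Z - m%:Z) = 1 ->
  i * (n%:Z - 2 * m%:Z) - j * (m%:Z + n%:Z) = -2 ->
  i * (m'%:Z + n'%:Z) + j * (2 * n'%:Z - m'%:Z) = 1 ->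
  i * (n'%:Z - 2 * m'%:Z) - j * (m'%:Z + n'%:Z) = 1 ->
  [/\ i = 1, j = 0, (m, n) = (1, 0)%N & (m', n') = (0, 1)%N].
Proof.
move=> e1 e2 e3 e4.
(* Weights depend on degrees through a 2 x 2 matrix of determinant
   3 (i^2 + i j + j^2), while the prescribed weights have determinant 3; so
   i^2 + i j + j^2 divides 1. *)
have N1 : i ^+ 2 + i * j + j ^+ 2 = 1.
  have detE : (i ^+ 2 + i * j + j ^+ 2) * (m%:Z * n'%:Z - m'%:Z * n%:Z) * 3 = 3.
    transitivity ((i * (m%:Z + n%:Z) + j * (2 * n%:Z - m%:Z)) *
        (i * (n'%:Z - 2 * m'%:Z) - j * (m'%:Z + n'%:Z)) -
        (i * (n%:Z - 2 * m%:Z) - j * (m%:Z + n%:Z)) *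
        (i * (m'%:Z + n'%:Z) + j * (2 * n'%:Z - m'%:Z))); first by ring.
    by rewrite e1 e2 e3 e4.
  move: detE; set N := (_ + _ + _); set D := (_ - _) => detE.
  have N0 : 0 <= N * 4.
    have -> : N * 4 = (2 * i + j) ^+ 2 + 3 * j ^+ 2 by rewrite /N; ring.
    by apply: addr_ge0; [exact: sqr_ge0 | apply: mulr_ge0 => //; exact: sqr_ge0].
  have ND : N * D = 1 by lia.
  have /eqP : (`|N| * `|D| = 1)%N by rewrite -abszM ND.
  by rewrite muln_eq1 => /andP[/eqP N1 _]; lia.
have bound (x y : int) : x ^+ 2 + x * y + y ^+ 2 = 1 -> -1 <= y <= 1.
  move=> N; have : 3 * y ^+ 2 <= 4.
    have -> : 3 * y ^+ 2 = 4 * (x ^+ 2 + x * y + y ^+ 2) - (2 * x + y) ^+ 2 by ring.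
    by rewrite N mulr1 lerBlDr lerDl sqr_ge0.
  by rewrite expr2; nia.
have jb := bound _ _ N1.
have ib : -1 <= i <= 1 by apply: (bound j); rewrite -[RHS]N1; ring.
have [ic|[ic|ic]] : i = -1 \/ i = 0 \/ i = 1 by lia.
all: have [jc|[jc|jc]] : j = -1 \/ j = 0 \/ j = 1 by lia.
all: subst i j; split; try (congr (_, _)); lia.
Qed.

Lemma weight_K2_unique (i j : int) :
  i * (1 + 0) + j * (2 * 0 - 1) = -1 -> i * (0 - 2 * 1) - j * (1 + 0) = -1 ->
  i = 0 /\ j = 1.
Proof. lia. Qed.

(** The hypotheses compare the exponents of p and q in the weights of K1^c K2^d on
    E1 and of K1^a K2^b on E2. *)
Lemma weight_symmetric (a b c d : int) :
  c * (1 + 0) + d * (2 * 0 - 1) = a * (0 + 1) + b * (2 * 1 - 0) ->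
  c * (0 - 2 * 1) - d * (1 + 0) = a * (1 - 2 * 0) - b * (0 + 1) ->
  b = c /\ a + b + d = 0.
Proof. lia. Qed.

Lemma degree_E1 (c d e : nat) : (d + e, c + d)%N = (1, 0)%N ->
  [/\ c = 0, d = 0 & e = 1]%N.
Proof. by case; split; lia. Qed.

Lemma degree_E2 (c d e : nat) : (d + e, c + d)%N = (0, 1)%N ->
  [/\ c = 1, d = 0 & e = 0]%N.
Proof. by case; split; lia. Qed.

(** * A spanning family of monomials *)

Section Borel.

Variables (F : fieldType) (r s p q : F).
Hypotheses (p0 : p != 0) (q0 : q != 0) (p3 : p ^+ 3 = r) (q3 : q ^+ 3 = s).

Local Notation V := (Uge0 r s p q).
Local Notation E1 := (UE1 r s p q).
Local Notation E2 := (UE2 r s p q).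
Local Notation K1 := (UK1 r s p q).
Local Notation K2 := (UK2 r s p q).

Definition pw (a b : int) : F := p ^ a * q ^ b.

Lemma pwD a b c d : pw (a + c) (b + d) = pw a b * pw c d.
Proof. by rewrite /pw !expfzDr //; ring. Qed.

Lemma pw0 : pw 0 0 = 1.
Proof. by rewrite /pw !expr0z mulr1. Qed.

Lemma pw_neq0 a b : pw a b != 0.
Proof. by rewrite mulf_neq0 // expfz_neq0. Qed.

Lemma pwMz a b i : pw (a * i) (b * i) = pw a b ^ i.
Proof. by rewrite /pw expfzMl !exprz_exp. Qed.

Definition E3 : V := E1 * E2 - s *: (E2 * E1).

Let rel i : (i < 11)%N -> nth 0 (relators r s p q (Ugen r s p q)) i = 0.
Proof. by move=> lti; apply: Ugen_relators; exact: mem_nth. Qed.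

Lemma K1K2 : K1 * K2 = K2 * K1.
Proof. exact: subr0_eq (@rel 4 isT). Qed.

Lemma K1E1 : qcomm (pw 1 (-2)) K1 E1.
Proof. exact: subr0_eq (@rel 5 isT). Qed.

Lemma K1E2 : qcomm (pw 1 1) K1 E2.
Proof. exact: subr0_eq (@rel 6 isT). Qed.

Lemma K2E1 : qcomm (pw (-1) (-1)) K2 E1.
Proof. exact: subr0_eq (@rel 7 isT). Qed.

Lemma K2E2 : qcomm (pw 2 (-1)) K2 E2.
Proof. exact: subr0_eq (@rel 8 isT). Qed.

Lemma serre1_relation :
  E1 ^+ 2 * E2 - (r + s) *: (E1 * E2 * E1) + (r * s) *: (E2 * E1 ^+ 2) = 0.
Proof. exact: (@rel 9 isT). Qed.

Lemma E1E3 : qcomm r E1 E3.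
Proof. by apply: subr0_eq; rewrite -serre1E; exact: serre1_relation. Qed.

Lemma E3E2 : qcomm r E3 E2.
Proof. by apply: subr0_eq; rewrite -serre2E; exact: (@rel 10 isT). Qed.

Lemma E1E2 : E1 * E2 = s *: (E2 * E1) + E3.
Proof. by rewrite /E3 addrC subrK. Qed.

(** Moving E1 to the right through E2 creates a single E3, which in turn moves to
    the right at the cost of a scalar. *)
Lemma E1_E2X n : exists g,
  E1 * E2 ^+ n.+1 = s ^+ n.+1 *: (E2 ^+ n.+1 * E1) + g *: (E2 ^+ n * E3).
Proof.
elim: n => [|n [g IHn]].
  by exists 1; rewrite !expr1 expr0 mul1r scale1r E1E2.
have E3E2n : E3 * E2 ^+ n.+1 = r ^+ n.+1 *: (E2 ^+ n.+1 * E3) by apply: qcommXr E3E2.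
exists (s * g + r ^+ n.+1); rewrite exprS mulrA E1E2 mulrDl E3E2n scalerDl addrA.
rewrite -scalerAl -[E2 * E1 * _]mulrA IHn mulrDr -!scalerAr scalerDr !scalerA -exprS.
by rewrite !mulrA -!exprS.
Qed.

Let uK1 : K1 \is a GRing.unit := UK1_unit r s p q.
Let uK2 : K2 \is a GRing.unit := UK2_unit r s p q.

(* Locked, so that products of the form _ * _ are not found inside it. *)
Definition Kmon (i j : int) : V := locked (K1 ^ i * K2 ^ j).

Lemma KmonE i j : Kmon i j = K1 ^ i * K2 ^ j.
Proof. by rewrite /Kmon -lock. Qed.

(** The scalar by which K1^i K2^j commutes with elements of degree (m, n) in
    (E1, E2). *)
Definition wt (i j m n : int) : F :=
  pw (i * (m + n) + j * (2 * n - m)) (i * (n - 2 * m) - j * (m + n)).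

Lemma wtDr i j m n m' n' : wt i j (m + m') (n + n') = wt i j m n * wt i j m' n'.
Proof. by rewrite /wt -pwD; congr pw; ring. Qed.

Lemma wt0 i j : wt i j 0 0 = 1.
Proof. by rewrite /wt -pw0; congr pw; ring. Qed.

Lemma wt_neq0 i j m n : wt i j m n != 0.
Proof. exact: pw_neq0. Qed.

Lemma KmonM i j i' j' : Kmon i j * Kmon i' j' = Kmon (i + i') (j + j').
Proof.
have cK : GRing.comm (K2 ^ j) (K1 ^ i').
  apply/commrXz/commr_sym/commrXz; exact: K1K2.
by rewrite !KmonE !exprzDr // !mulrA -[_ * K2 ^ j * K1 ^ i']mulrA cK !mulrA.
Qed.

Lemma Kmon00 : Kmon 0 0 = 1.
Proof. by rewrite !KmonE !expr0z mulr1. Qed.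

Lemma Kmon_E1 i j : qcomm (wt i j 1 0) (Kmon i j) E1.
Proof.
have -> : wt i j 1 0 = pw 1 (-2) ^ i * pw (-1) (-1) ^ j.
  by rewrite -!pwMz -pwD; congr pw; ring.
by rewrite KmonE; apply: qcommMl; apply: qcommXzl; rewrite ?pw_neq0 //; [exact: K1E1|exact: K2E1].
Qed.

Lemma Kmon_E2 i j : qcomm (wt i j 0 1) (Kmon i j) E2.
Proof.
have -> : wt i j 0 1 = pw 1 1 ^ i * pw 2 (-1) ^ j.
  by rewrite -!pwMz -pwD; congr pw; ring.
by rewrite KmonE; apply: qcommMl; apply: qcommXzl; rewrite ?pw_neq0 //; [exact: K1E2|exact: K2E2].
Qed.

Lemma Kmon_E3 i j : qcomm (wt i j 1 1) (Kmon i j) E3.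
Proof.
have e12 : qcomm (wt i j 1 1) (Kmon i j) (E1 * E2).
  by rewrite -[1]addr0 -[X in wt _ _ _ X]add0r wtDr; apply: qcommMr (Kmon_E1 _ _) (Kmon_E2 _ _).
have e21 : qcomm (wt i j 1 1) (Kmon i j) (E2 * E1).
  by rewrite -[1]addr0 -[X in wt _ _ X _]add0r wtDr; apply: qcommMr (Kmon_E2 _ _) (Kmon_E1 _ _).
by apply: qcommDr e12 _; rewrite -scaleNr; exact: qcommZr e21.
Qed.

Lemma wtX i j m n k : wt i j m n ^+ k = wt i j (m *+ k) (n *+ k).
Proof.
elim: k => [|k IHk]; first by rewrite expr0 !mulr0n wt0.
by rewrite exprS IHk !mulrS wtDr.
Qed.

(** The index ((i, j), (c, d, e)) stands for K1^i K2^j E2^c E3^d E1^e. *)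
Definition pbw_index : choiceType := ((int * int) * (nat * nat * nat))%type.

Definition pbw (k : pbw_index) : V :=
  let: ((i, j), (c, d, e)) := k in Kmon i j * (E2 ^+ c * E3 ^+ d * E1 ^+ e).

(** The degree in E1 and in E2, where E3 has degree (1, 1). *)
Definition pbw_deg (k : pbw_index) : nat * nat :=
  let: ((i, j), (c, d, e)) := k in ((d + e)%N, (c + d)%N).

Lemma Kmon_pbw i j k :
  qcomm (wt i j (pbw_deg k).1 (pbw_deg k).2) (Kmon i j) (pbw k).
Proof.
case: k => [[i' j'] [[c d] e]] /=.
have -> : wt i j (d + e)%N (c + d)%N =
    1 * (wt i j 0 1 ^+ c * wt i j 1 1 ^+ d * wt i j 1 0 ^+ e).
  by rewrite !wtX -!wtDr mul1r; congr wt; rewrite ?mul0rn -?natz; lia.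
apply: qcommMr; first by rewrite /qcomm scale1r !KmonM addrC [j + _]addrC.
by do 2?apply: qcommMr; apply: qcommXr; [exact: Kmon_E2|exact: Kmon_E3|exact: Kmon_E1].
Qed.

Definition pbw_sum : {malg F[pbw_index]} -> V := mmap (in_alg V) pbw.

HB.instance Definition _ := GRing.Additive.on pbw_sum.

Lemma pbw_sumw (D : {fset pbw_index}) y : (msupp y `<=` D)%fset ->
  pbw_sum y = \sum_(k <- D) y@_k *: pbw k.
Proof.
by move=> yD; rewrite /pbw_sum (mmapEw yD); apply: eq_bigr => k _; rewrite mulr_algl.
Qed.

Lemma pbw_sumZ c y : pbw_sum (c *: y) = c *: pbw_sum y.
Proof.
rewrite (pbw_sumw (msuppZ_le c y)) (pbw_sumw (fsubset_refl _)) scaler_sumr.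
by apply: eq_bigr => k _; rewrite mcoeffZ scalerA.
Qed.

Lemma pbw_sumU c k : pbw_sum << c *g k >> = c *: pbw k.
Proof. by rewrite /pbw_sum mmapU mulr_algl. Qed.

(** The span of the monomials contains 1 and is stable under left multiplication
    by the generators; only E1 requires reordering. *)
Lemma pbw_span x : exists y, x = pbw_sum y.
Proof.
pose P x := exists y, x = pbw_sum y.
have P0 : P 0 by exists 0; rewrite raddf0.
have PD a b : P a -> P b -> P (a + b).
  by case=> y -> [z ->]; exists (y + z); rewrite raddfD.
have PZ c a : P a -> P (c *: a) by case=> y ->; exists (c *: y); rewrite pbw_sumZ.
have Pb k : P (pbw k) by exists << 1 *g k >>; rewrite pbw_sumU scale1r.
have Pmul (g : V) : (forall k, P (g * pbw k)) -> forall a, P a -> P (g * a).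
  move=> Pg _ [y ->]; rewrite (pbw_sumw (fsubset_refl _)) mulr_sumr.
  by elim/big_rec: _ => // k z _; apply: (PD); rewrite -scalerAr; exact: PZ.
have PK i j k : P (Kmon i j * pbw k).
  case: k => [[i' j'] cde]; rewrite /pbw; case: cde => [[c d] e].
  by rewrite mulrA KmonM; exact: (Pb ((_, _), (c, d, e))).
have PE c (g : V) i j a : c != 0 -> qcomm c (Kmon i j) g -> P (Kmon i j * (g * a)) ->
    P (g * (Kmon i j * a)).
  move=> c0 /(qcomm_sym c0) Kg Pa; rewrite [g * (Kmon i j * a)]mulrA Kg -scalerAl -mulrA; exact: PZ.
move: x; apply: Uge0_ind => //.
  by rewrite -Kmon00 -[Kmon 0 0]mulr1; rewrite -[1]mulr1 -[1 * 1]mulr1; exact: (Pb ((0, 0), (0, 0, 0)%N)).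
case=> a; apply: Pmul => k.
- case: k => [[i j] [[c d] e]]; apply: PE (wt_neq0 _ _ _ _) (Kmon_E1 i j) _.
  have E1d : E1 * E3 ^+ d = r ^+ d *: (E3 ^+ d * E1) by apply: qcommXr E1E3.
  have Pe0 g c' : E1 * E2 ^+ c = g *: (E2 ^+ c * E1) + c' -> P (Kmon i j * (c' * E3 ^+ d * E1 ^+ e)) ->
      P (Kmon i j * (E1 * (E2 ^+ c * E3 ^+ d * E1 ^+ e))).
    move=> eqE Pc'; rewrite !mulrA -[Kmon i j * E1 * _]mulrA eqE mulrDr !mulrDl.
    apply: (PD); last by move: Pc'; rewrite !mulrA.
    rewrite -scalerAr -!scalerAl; apply: (PZ).
    rewrite -!mulrA [E1 * (_ * _)]mulrA E1d -scalerAl -!scalerAr; apply: (PZ).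
    by rewrite -[_ * E1 * _]mulrA -exprS [E2 ^+ c * _]mulrA; exact: (Pb ((i, j), (c, d, e.+1))).
  case: c => [|c] in Pe0 *.
    apply: (Pe0 1 0); first by rewrite expr0 mulr1 mul1r scale1r addr0.
    by rewrite !mul0r mulr0.
  have [g /Pe0] := E1_E2X c; apply.
  rewrite -!scalerAl -scalerAr; apply: (PZ).
  by rewrite -[_ * E3 * _]mulrA -exprS; exact: (Pb ((i, j), (c, d.+1, e))).
- case: k => [[i j] [[c d] e]]; apply: PE (wt_neq0 _ _ _ _) (Kmon_E2 i j) _.
  by rewrite [E2 * _]mulrA [E2 * (_ * _)]mulrA -exprS; exact: (Pb ((i, j), (c.+1, d, e))).
- by have := PK 1 0 k; rewrite !KmonE expr1z expr0z mulr1.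
- by have := PK (-1) 0 k; rewrite !KmonE expr0z mulr1 exprN1 UK1V.
- by have := PK 0 1 k; rewrite !KmonE expr1z expr0z mul1r.
- by have := PK 0 (-1) k; rewrite !KmonE expr0z mul1r exprN1 UK2V.
Qed.

(** * Embedding into a quantum torus *)

(** The scalars of the products of ordered monomials K1^i K2^j B^c A'^b A^a: moving
    A, A', B to the right through K1, K2 costs the inverse of a weight, and the
    terms with coefficient 3 encode A B = s B A, A' B = r B A' and
    A A' = (r/s) A' A, where r = p^3 and s = q^3. *)
Definition torus_bichar (x y : expo) : F :=
  let: (a, (a', (c, _))) := x in let: (_, (b', (d, (i, j)))) := y in
  pw (3 * (a' * d + a * b') - i * (a + a' + c) - j * (2 * c - (a + a')))
     (3 * (a * d - a * b') - i * (c - 2 * (a + a')) + j * (a + a' + c)).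

Lemma torus_bicharP : bicharacter torus_bichar.
Proof.
split.
- move=> [a [a' [c k]]] [b [b' [d l]]] [e [e' [f [i j]]]] /=.
  by rewrite -pwD; congr (pw _ _); ring.
- move=> [a [a' [c k]]] [b [b' [d [i j]]]] [e [e' [f [i' j']]]] /=.
  by rewrite -pwD; congr (pw _ _); ring.
- by move=> [a [a' [c k]]] [b [b' [d [i j]]]]; exact: pw_neq0.
Qed.

Local Notation torus := (twisted torus_bicharP).
Local Notation X := (tmon torus_bicharP).

Definition eA : expo := (1, (0, (0, (0, 0)))).
Definition eA' : expo := (0, (1, (0, (0, 0)))).
Definition eB : expo := (0, (0, (1, (0, 0)))).
Definition eK1 : expo := (0, (0, (0, (1, 0)))).
Definition eK2 : expo := (0, (0, (0, (0, 1)))).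

Definition torus_gen (g : gen) : torus :=
  match g with
  | gE1 => X eA + X eA'
  | gE2 => X eB
  | gK1 => X eK1
  | gK1V => X (- eK1)
  | gK2 => X eK2
  | gK2V => X (- eK2)
  end.

Let r_pw : r = pw 3 0.
Proof. by rewrite -p3 /pw expr0z mulr1. Qed.

Let s_pw : s = pw 0 3.
Proof. by rewrite -q3 /pw expr0z mul1r. Qed.

Lemma torus_qcomm c d e : torus_bichar d e = c * torus_bichar e d ->
  qcomm c (X d) (X e).
Proof. exact: (tmonC torus_bicharP). Qed.

Lemma torus_AB : qcomm s (X eA) (X eB).
Proof. by apply: torus_qcomm; rewrite s_pw -pwD. Qed.

Lemma torus_A'B : qcomm r (X eA') (X eB).
Proof. by apply: torus_qcomm; rewrite r_pw -pwD. Qed.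

Lemma torus_AA' : qcomm (r / s) (X eA) (X eA').
Proof.
have s0 : s != 0 by rewrite -q3 expf_neq0.
apply: torus_qcomm; apply: (mulfI s0); rewrite [RHS]mulrA [s * (r / s)]mulrC divfK //.
by rewrite [in RHS]r_pw [X in X * _ = _]s_pw -!pwD.
Qed.

Lemma torus_relators : {in relators r s p q torus_gen, forall y, y = 0}.
Proof.
have inv d e : d + e = 0 -> torus_bichar d e = 1 -> X d * X e - 1 = 0.
  by rewrite tmonM => -> ->; rewrite scale1r subrr.
have b0 d e : torus_bichar d e = pw 0 0 -> torus_bichar d e = 1 by rewrite pw0.
have comm c (x y : torus) : qcomm c x y -> x * y - c *: (y * x) = 0.
  by move=> ->; rewrite subrr.
have s0 : s != 0 by rewrite -q3 expf_neq0.
have [serre1 serre2] := serre_skew s0 torus_AB torus_A'B torus_AA'.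
have cons y0 (l : seq torus) : y0 = 0 -> {in l, forall y, y = 0} ->
    {in y0 :: l, forall y, y = 0}.
  by move=> y00 l0 y; rewrite inE => /predU1P[->|/l0].
rewrite /relators; apply: (cons); last apply: (cons); last apply: (cons);
  last apply: (cons); last apply: (cons); last apply: (cons); last apply: (cons);
  last apply: (cons); last apply: (cons); last apply: (cons);
  last apply: (cons) => //.
- by apply: inv; [exact: subrr | exact: b0].
- by apply: inv; [exact: addNr | exact: b0].
- by apply: inv; [exact: subrr | exact: b0].
- by apply: inv; [exact: addNr | exact: b0].
- by rewrite -[X in _ - X]scale1r; apply/comm/torus_qcomm; rewrite mul1r.
- by apply: (comm (pw 1 (-2))); apply: qcommDr; apply: torus_qcomm; rewrite -pwD.
- by apply: (comm (pw 1 1)); apply: torus_qcomm; rewrite -pwD.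
- by apply: (comm (pw (-1) (-1))); apply: qcommDr; apply: torus_qcomm; rewrite -pwD.
- by apply: (comm (pw 2 (-1))); apply: torus_qcomm; rewrite -pwD.
- exact: serre1.
Qed.

(** * Consequences: a basis, no zero divisors, the invertible elements *)

Hypothesis pq_indep : forall a b : int, pw a b = 1 -> a = 0 /\ b = 0.

Lemma pw_inj a b c d : pw a b = pw c d -> a = c /\ b = d.
Proof.
move=> e; have : pw (a - c) (b - d) = 1.
  apply: (mulIf (pw_neq0 c d)).
  by rewrite -pwD !subrK mul1r.
by case/pq_indep => /subr0_eq-> /subr0_eq->.
Qed.

Let r2_neq_s2 : r ^+ 2 != s ^+ 2.
Proof.
apply/eqP => rs; have : pw 6 0 = pw 0 6.
  by rewrite /pw !expr0z mulr1 mul1r -[p ^ 6]/(p ^+ (3 * 2)) -[q ^ 6]/(q ^+ (3 * 2)) !exprM p3 q3.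
by case/pw_inj.
Qed.

Let rs : r != s.
Proof. by apply: contraNneq r2_neq_s2 => ->. Qed.

Let rDs : r + s != 0.
Proof.
apply: contraNneq r2_neq_s2 => rs0.
by rewrite -subr_eq0 subr_sqr rs0 mulr0.
Qed.

(** The leading exponent of the image of a monomial: A from E1 = A + A', and B A'
    from E3. *)
Definition pbw_expo (k : pbw_index) : expo :=
  let: ((i, j), (c, d, e)) := k in (e%:Z, (d%:Z, ((c + d)%N%:Z, (i, j)))).

Lemma pbw_expo_inj : injective pbw_expo.
Proof.
by move=> [[i j] [[c d] e]] [[i' j'] [[c' d'] e']] [-> -> + -> ->] => /addIn ->.
Qed.

(** Images of the K1^i K2^j are monomials up to scalars, so they have the same
    leading exponent for every cone. *)
Lemma torus_embedding : exists rho : {lrmorphism V -> torus},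
  (forall P i j, pos_cone P -> lead P (rho (Kmon i j)) (0, (0, (0, (i, j))))) /\
  (forall k, lead expo_cone (rho (pbw k)) (pbw_expo k)).
Proof.
have [rho rhoE] := Uge0_lift torus_relators.
have leadK1 P i : pos_cone P -> lead P (rho (K1 ^ i)) (0, (0, (0, (i, 0)))).
  move=> hP; case: i => n.
    have := leadX hP n (lead_tmon torus_bicharP P eK1).
    by rewrite expoMn !mul0rn natz -[tmon _ _]/(torus_gen gK1) -rhoE -rmorphXn.
  have := leadX hP n.+1 (lead_tmon torus_bicharP P (- eK1)).
  rewrite expoMn oppr0 !mul0rn mulNrn natz -[tmon _ _]/(torus_gen gK1V) -rhoE -rmorphXn.
  by rewrite NegzE -exprnN -exprVn UK1V.
have leadK2 P i : pos_cone P -> lead P (rho (K2 ^ i)) (0, (0, (0, (0, i)))).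
  move=> hP; case: i => n.
    have := leadX hP n (lead_tmon torus_bicharP P eK2).
    by rewrite expoMn !mul0rn natz -[tmon _ _]/(torus_gen gK2) -rhoE -rmorphXn.
  have := leadX hP n.+1 (lead_tmon torus_bicharP P (- eK2)).
  rewrite expoMn oppr0 !mul0rn mulNrn natz -[tmon _ _]/(torus_gen gK2V) -rhoE -rmorphXn.
  by rewrite NegzE -exprnN -exprVn UK2V.
have leadK P i j : pos_cone P -> lead P (rho (Kmon i j)) (0, (0, (0, (i, j)))).
  move=> hP; rewrite KmonE rmorphM.
  by have := leadM hP (leadK1 P i hP) (leadK2 P j hP); rewrite expoD !addr0 add0r.
exists rho; split=> // [[[i j] [[c d] e]]] /=.
have hP := pos_cone_expo.
have leadE1 : lead expo_cone (rho E1) eA.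
  rewrite [rho _](rhoE gE1) /=; split=> [|x]; rewrite mcoeffD !mcoeff_tmon.
    by rewrite eqxx addr0 oner_eq0.
  case: (eqVneq eA x) => [<-|_]; first by left.
  by case: (eqVneq eA' x) => [<-|_]; [right | rewrite addr0 eqxx].
have leadE2 : lead expo_cone (rho E2) eB.
  by rewrite [rho _](rhoE gE2); exact: lead_tmon.
have leadE3 : lead expo_cone (rho E3) (eB + eA').
  have rhoZ a x : rho (a *: x) = a *: rho x by exact: linearZ.
  have rhoB x y : rho (x - y) = rho x - rho y by exact: rmorphB.
  have rhoM x y : rho (x * y) = rho x * rho y by exact: rmorphM.
  rewrite rhoB rhoZ !rhoM [rho E1](rhoE gE1) [rho E2](rhoE gE2).
  rewrite [_ - _](skew_commutator torus_AB torus_A'B); apply: leadZ.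
    by rewrite subr_eq0.
  exact: leadM (lead_tmon _ _ _) (lead_tmon _ _ _).
have := leadM hP (leadK _ i j hP) (leadM hP (leadM hP (leadX hP c leadE2)
  (leadX hP d leadE3)) (leadX hP e leadE1)).
rewrite expoD !expoMn -!rmorphXn -!rmorphM.
set x := (X in lead _ _ X -> _); set y := (X in _ -> lead _ _ X); suff -> : x = y by [].
rewrite /x /y !expoD !mul0rn !add0r !addr0 !natz.
by rewrite PoszD.
Qed.

Lemma lead_pbw_sum (rho : {lrmorphism V -> torus}) (y : {malg F[pbw_index]}) :
  (forall k, lead expo_cone (rho (pbw k)) (pbw_expo k)) -> y != 0 ->
  exists k, lead expo_cone (rho (pbw_sum y)) (pbw_expo k).
Proof.
move=> rho_lead /(lead_lincomb pos_cone_expo pbw_expo_inj rho_lead)[k yk].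
have rhoZ a x : rho (a *: x) = a *: rho x by exact: linearZ.
exists k; rewrite (pbw_sumw (fsubset_refl _)) raddf_sum.
by rewrite (eq_bigr (fun i => y@_i *: rho (pbw i))) // => i _; exact: rhoZ.
Qed.

Lemma lead_rho (rho : {lrmorphism V -> torus}) x :
  (forall k, lead expo_cone (rho (pbw k)) (pbw_expo k)) -> x != 0 ->
  exists k, lead expo_cone (rho x) (pbw_expo k).
Proof.
have [y ->] := pbw_span x; move=> rho_lead y0; apply: lead_pbw_sum => //.
by apply: contraNneq y0 => ->; rewrite raddf0.
Qed.

Lemma pbw_free y : pbw_sum y = 0 -> y = 0.
Proof.
have [rho [_ rho_lead]] := torus_embedding.
move=> y0; apply/eqP; apply: contraT => /(lead_pbw_sum rho_lead)[k].
by rewrite y0 raddf0 => /lead_neq0; rewrite eqxx.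
Qed.

Lemma Uge0_domain (x y : V) : x * y = 0 -> x = 0 \/ y = 0.
Proof.
have [rho [_ rho_lead]] := torus_embedding.
case: (eqVneq x 0) => [|/(lead_rho rho_lead)[k xk]]; first by left.
case: (eqVneq y 0) => [|/(lead_rho rho_lead)[l yl]]; first by right.
have := lead_neq0 (leadM pos_cone_expo xk yl).
by rewrite -rmorphM => + xy0; rewrite xy0 raddf0 eqxx.
Qed.

(** The exponents of A, A', B in leading monomials are natural numbers, and they
    add up to 0 for an element and its inverse. *)
Lemma Uge0_right_inverse (x y : V) : x * y = 1 ->
  exists c i j, c != 0 /\ y = c *: Kmon i j.
Proof.
have [rho [rhoK rho_lead]] := torus_embedding.
move=> xy1; have rxy : rho x * rho y = 1 by rewrite -rmorphM xy1 rmorph1.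
have [d [xd yd yd']] := twisted_unit pos_cone_expo rxy.
have x0 : x != 0 by apply: contra_eq_neq xy1 => ->; rewrite mul0r eq_sym oner_neq0.
have y0 : y != 0 by apply: contra_eq_neq xy1 => ->; rewrite mulr0 eq_sym oner_neq0.
have [k xk] := lead_rho rho_lead x0; have [l yl] := lead_rho rho_lead y0.
have : pbw_expo k + pbw_expo l = 0.
  by rewrite (lead_uniq pos_cone_expo xk xd) (lead_uniq pos_cone_expo yl yd) addNr.
move: yl => /(lead_uniq pos_cone_expo yd).
case: k {xk} => [[i' j'] [[a' b'] c']]; case: l => [[i j] [[a b] c]] dE /=.
rewrite expoD => -[cc bb aa _ _].
have add0 (m n : nat) : (m + n)%N = 0%N -> n = 0%N.
  by move/eqP; rewrite addn_eq0 => /andP[_ /eqP].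
have {aa bb cc} dE : d = (0, (0, (0, (i, j)))).
  by rewrite dE /= (add0 _ _ cc) (add0 _ _ aa) (add0 _ _ bb).
have hN := pos_cone_opp pos_cone_expo.
have rhoK2 := lead_mono pos_cone_expo (rhoK _ i j pos_cone_expo) (rhoK _ i j hN).
have := lead_mono pos_cone_expo yd yd'; rewrite dE.
set a1 := (rho y)@__ => rhoy; move: rhoK2; set a2 := (rho _)@__ => rhok.
have a10 : a1 != 0 by rewrite /a1 -dE; case: yd.
have a20 : a2 != 0 by case: (rhoK _ i j pos_cone_expo).
exists (a1 / a2), i, j; split; first by rewrite mulf_neq0 ?invr_eq0.
apply/eqP; rewrite -subr_eq0; apply: contraT => /(lead_rho rho_lead)[k].
have rhoZ u v : rho (u *: v) = u *: rho v by exact: linearZ.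
have rhoB u v : rho (u - v) = rho u - rho v by exact: rmorphB.
rewrite rhoB rhoZ rhok rhoy scalerA divfK // subrr => /lead_neq0.
by rewrite eqxx.
Qed.

(** Distinct monomials are independent, so each of those occurring in an
    eigenvector of K1^i K2^j is itself an eigenvector for the same weight. *)
Lemma Kmon_eigen i j c y :
  qcomm c (Kmon i j) (pbw_sum y) ->
  forall k, y@_k != 0 -> wt i j (pbw_deg k).1 (pbw_deg k).2 = c.
Proof.
move=> Ky; pose w k := wt i j (pbw_deg k).1 (pbw_deg k).2.
pose z : {malg F[pbw_index]} := [malg k in msupp y => w k * y@_k].
have zE k : z@_k = w k * y@_k.
  by rewrite mcoeffE; case: ifPn => // /mcoeff_outdom ->; rewrite mulr0.
have zy : (msupp z `<=` msupp y)%fset.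
  by apply/fsubsetP => k; rewrite -!mcoeff_neq0 zE mulf_eq0 negb_or => /andP[].
have Kz : Kmon i j * pbw_sum y = pbw_sum z * Kmon i j.
  rewrite (pbw_sumw zy) (pbw_sumw (fsubset_refl _)) mulr_sumr mulr_suml.
  apply: eq_bigr => k _; rewrite zE -scalerAr Kmon_pbw scalerA mulrC.
  by rewrite -scalerAl.
have : pbw_sum (z - c *: y) * Kmon i j = 0.
  have -> : pbw_sum (z - c *: y) = pbw_sum z - c *: pbw_sum y.
    by rewrite -pbw_sumZ; exact: raddfB.
  by rewrite mulrBl -scalerAl -Kz Ky subrr.
case/Uge0_domain => [/pbw_free zcy k yk|K0].
  have : (z - c *: y)@_k = 0 by rewrite zcy mcoeff0.
  rewrite mcoeffB mcoeffZ zE -mulrBl => /eqP.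
  by rewrite mulf_eq0 (negbTE yk) orbF subr_eq0 => /eqP.
have := KmonM i j (- i) (- j).
rewrite K0 mul0r !subrr Kmon00 => /esym/eqP.
by rewrite oner_eq0.
Qed.

(** * Automorphisms *)

Lemma KmonK1 : Kmon 1 0 = K1.
Proof. by rewrite KmonE expr1z expr0z mulr1. Qed.

Lemma KmonK2 : Kmon 0 1 = K2.
Proof. by rewrite KmonE expr1z expr0z mul1r. Qed.

Lemma pbwE1 i j : pbw ((i, j), (0, 0, 1)%N) = Kmon i j * E1.
Proof. by rewrite /pbw !expr0 !mul1r expr1. Qed.

Lemma pbwE2 i j : pbw ((i, j), (1, 0, 0)%N) = Kmon i j * E2.
Proof. by rewrite /pbw !expr0 !mulr1 expr1. Qed.

Lemma pbw_neq0 k : pbw k != 0.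
Proof.
apply: contraTneq (oner_neq0 F) => k0; rewrite negbK.
rewrite -(monalgU_eq0 _ k); apply/eqP; apply: pbw_free.
by rewrite pbw_sumU scale1r.
Qed.

Lemma E1_neq0 : E1 != 0.
Proof. by have := pbw_neq0 ((0, 0), (0, 0, 1)%N); rewrite pbwE1 Kmon00 mul1r. Qed.

Lemma E2_neq0 : E2 != 0.
Proof. by have := pbw_neq0 ((0, 0), (1, 0, 0)%N); rewrite pbwE2 Kmon00 mul1r. Qed.

Lemma Uge0_mulIr (x y z : V) : z != 0 -> x * z = y * z -> x = y.
Proof.
move=> z0 /eqP; rewrite -subr_eq0 -mulrBl => /eqP.
case/Uge0_domain => [/subr0_eq//|z00].
by rewrite z00 eqxx in z0.
Qed.

Lemma pbw_sum_exists (y : {malg F[pbw_index]}) : pbw_sum y != 0 -> exists k, y@_k != 0.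
Proof.
move=> y0; apply: contrapT => no; move/eqP: y0; apply.
rewrite (pbw_sumw (fsubset_refl _)) big1 // => k _.
case: (eqVneq (y@_k) 0) => [->|yk]; first by rewrite scale0r.
by case: no; exists k.
Qed.

Section Endomorphism.

Variable theta : {lrmorphism V -> V}.
Hypothesis theta_inj : injective theta.

Let thetaM x y : theta (x * y) = theta x * theta y.
Proof. exact: rmorphM. Qed.
Let thetaZ a x : theta (a *: x) = a *: theta x.
Proof. exact: linearZ. Qed.
Let thetaD x y : theta (x + y) = theta x + theta y.
Proof. exact: rmorphD. Qed.
Let thetaB x y : theta (x - y) = theta x - theta y.
Proof. exact: rmorphB. Qed.
Let thetaX x n : theta (x ^+ n) = theta x ^+ n.
Proof. exact: rmorphXn. Qed.
Let theta_neq0 x : x != 0 -> theta x != 0.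
Proof. by move=> x0; apply: contraNneq x0 => tx; apply/eqP/theta_inj; rewrite tx rmorph0. Qed.

Lemma theta_qcomm a i j x c y : a != 0 -> theta x = a *: Kmon i j ->
  qcomm c x y -> qcomm c (Kmon i j) (theta y).
Proof.
move=> a0 tx /(congr1 theta); rewrite /qcomm thetaZ !thetaM tx -scalerAr -scalerAl.
by rewrite scalerA mulrC -scalerA => /(scalerI a0).
Qed.

(** theta K1 and theta K2 are invertible, hence monomials up to scalars; so every
    monomial occurring in theta E1 or theta E2 has prescribed weights under
    them, and weight rigidity leaves only one possible degree. *)
Lemma theta_diagonal : exists a1 a2 f1 f2,
  [/\ a1 != 0, a2 != 0 & theta K1 = a1 *: K1] /\
  [/\ theta K2 = a2 *: K2, theta E1 = f1 * E1 & theta E2 = f2 * E2].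
Proof.
have K1VK1 : K1^-1 * K1 = 1 by exact: mulVr (UK1_unit r s p q).
have K2VK2 : K2^-1 * K2 = 1 by exact: mulVr (UK2_unit r s p q).
have tu x y : x * y = 1 -> theta x * theta y = 1 by rewrite -thetaM => ->; exact: rmorph1.
have [a1 [i1 [j1 [a10 tK1]]]] := Uge0_right_inverse (tu _ _ K1VK1).
have [a2 [i2 [j2 [a20 tK2]]]] := Uge0_right_inverse (tu _ _ K2VK2).
have [y1 y1E] := pbw_span (theta E1).
have [y2 y2E] := pbw_span (theta E2).
have wE i j c y x z (yE : theta z = pbw_sum y) a :
    a != 0 -> theta x = a *: Kmon i j -> qcomm c x z ->
    forall k, y@_k != 0 -> wt i j (pbw_deg k).1 (pbw_deg k).2 = c.
  move=> a0 tx xz; apply: Kmon_eigen; rewrite -yE.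
  exact: theta_qcomm tx xz.
have w11 := wE _ _ _ _ _ _ y1E _ a10 tK1 K1E1.
have w12 := wE _ _ _ _ _ _ y2E _ a10 tK1 K1E2.
have w21 := wE _ _ _ _ _ _ y1E _ a20 tK2 K2E1.
have [k1 y1k] : exists k, y1@_k != 0.
  by apply: pbw_sum_exists; rewrite -y1E; apply: theta_neq0 E1_neq0.
have [k2 y2k] : exists k, y2@_k != 0.
  by apply: pbw_sum_exists; rewrite -y2E; apply: theta_neq0 E2_neq0.
have rig k l : y1@_k != 0 -> y2@_l != 0 ->
    [/\ i1 = 1, j1 = 0, pbw_deg k = (1, 0)%N & pbw_deg l = (0, 1)%N].
  move=> /w11/pw_inj[e1 e2] /w12/pw_inj[e3 e4].
  have := weight_rigidity e1 e2 e3 e4.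
  by rewrite -!surjective_pairing.
have [i1E j1E dk1 _] := rig _ _ y1k y2k.
have [i2E j2E] : i2 = 0 /\ j2 = 1.
  by have /pw_inj[] := w21 _ y1k; rewrite dk1; exact: weight_K2_unique.
have left_mult (y : {malg F[pbw_index]}) (x : V) (h : pbw_index -> V) :
    (forall k, y@_k != 0 -> pbw k = h k * x) -> exists f, pbw_sum y = f * x.
  move=> yh; exists (\sum_(k <- msupp y) y@_k *: h k).
  rewrite (pbw_sumw (fsubset_refl _)) mulr_suml !big_seq.
  by apply: eq_bigr => k; rewrite -mcoeff_neq0 => /yh ->; rewrite scalerAl.
have [f1 f1E] : exists f, pbw_sum y1 = f * E1.
  apply: (left_mult _ _ (fun k => Kmon k.1.1 k.1.2)) => k /rig/(_ y2k)[_ _ + _].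
  by case: k => [[i j] [[c d] e]] /degree_E1[-> -> ->]; exact: pbwE1.
have [f2 f2E] : exists f, pbw_sum y2 = f * E2.
  apply: (left_mult _ _ (fun k => Kmon k.1.1 k.1.2)) => k /(rig _ _ y1k)[_ _ _].
  by case: k => [[i j] [[c d] e]] /degree_E2[-> -> ->]; exact: pbwE2.
exists a1, a2, f1, f2; rewrite y1E y2E tK1 tK2 i1E i2E j1E j2E KmonK1 KmonK2.
by split.
Qed.

(** With x, y the images of E1, E2 up to scalars, the three monomials of the Serre
    relation pick up the factors u^2, u v, v^2, where u^-1 and v^-1 are the weights
    of K1^c K2^d on E1 and of K1^a K2^b on E2.  Eliminating E1^2 E2 leaves
    (r + s) u (u - v) as the coefficient of E3 E1, whence u = v. *)
Lemma theta_serre b1 b2 a b c d : b1 != 0 -> b2 != 0 ->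
  theta E1 = b1 *: (Kmon a b * E1) -> theta E2 = b2 *: (Kmon c d * E2) ->
  b = c /\ a + b + d = 0.
Proof.
move=> b10 b20 tE1 tE2.
pose serre (x y : V) := x ^+ 2 * y - (r + s) *: (x * y * x) + (r * s) *: (y * x ^+ 2).
have S0 : serre E1 E2 = 0 by exact: serre1_relation.
pose x := Kmon a b * E1; pose y := Kmon c d * E2.
have Sxy : serre x y = 0.
  have : serre (theta E1) (theta E2) = 0.
    have -> : serre (theta E1) (theta E2) = theta (serre E1 E2).
      by rewrite /serre !(thetaB, thetaD, thetaZ, thetaX, thetaM).
    by rewrite S0; exact: rmorph0.
  rewrite tE1 tE2 -/x -/y.
  have -> : serre (b1 *: x) (b2 *: y) = (b1 ^+ 2 * b2) *: serre x y.
    rewrite /serre !exprZn -!(scalerAl, scalerAr) !scalerA.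
    rewrite scalerDr scalerBr !scalerA.
    by congr (_ *: _ - _ *: _ + _ *: _); ring.
  by move/eqP; rewrite scaler_eq0 mulf_eq0 expf_eq0 (negbTE b10) (negbTE b20) /= => /eqP.
pose u := (wt c d 1 0)^-1; pose v := (wt a b 0 1)^-1; pose w := (wt a b 1 0)^-1.
have wn0 i j m n : wt i j m n != 0 by exact: wt_neq0.
have cu : qcomm u E1 (Kmon c d) by apply: qcomm_sym (wn0 _ _ _ _) (Kmon_E1 _ _).
have cv : qcomm v E2 (Kmon a b) by apply: qcomm_sym (wn0 _ _ _ _) (Kmon_E2 _ _).
have cw : qcomm w E1 (Kmon a b) by apply: qcomm_sym (wn0 _ _ _ _) (Kmon_E1 _ _).
pose k := Kmon a b * Kmon c d.
have kC : Kmon c d * Kmon a b = k by rewrite /k !KmonM [c + a]addrC [d + b]addrC.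
have xy : x * y = u *: (k * (E1 * E2)).
  by rewrite /x /y -mulrA [E1 * _]mulrA cu -scalerAl -scalerAr -!mulrA.
have yx : y * x = v *: (k * (E2 * E1)).
  by rewrite /x /y -mulrA [E2 * _]mulrA cv -scalerAl -scalerAr -kC -!mulrA.
have ck : qcomm (w * u) E1 k by exact: qcommMr.
have cK : k * Kmon a b = Kmon a b * k by rewrite {1}/k -mulrA kC.
have xk z : x * (k * z) = (w * u) *: (Kmon a b * k * (E1 * z)).
  by rewrite /x -mulrA [E1 * _]mulrA ck -scalerAl -scalerAr -!mulrA.
have kx z c' : qcomm c' z (Kmon a b) -> k * z * x = c' *: (Kmon a b * k * (z * E1)).
  move=> zc; rewrite /x -[k * z * _]mulrA [z * (_ * _)]mulrA zc -scalerAl -scalerAr -[_ * z * _]mulrA.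
  by rewrite [k * (_ * _)]mulrA cK.
pose N := E2 * E1 ^+ 2; pose M := E1 * E2 * E1.
have t1 : x ^+ 2 * y = (w * u ^+ 2) *: (Kmon a b * k * (E1 ^+ 2 * E2)).
  rewrite !expr2 -mulrA xy -scalerAr xk scalerA -[E1 * E1 * E2]mulrA.
  by congr (_ *: _); ring.
have t2 : x * y * x = (w * (u * v)) *: (Kmon a b * k * M).
  rewrite -mulrA yx -scalerAr xk scalerA /M -[E1 * E2 * E1]mulrA.
  by congr (_ *: _); ring.
have t3 : y * x ^+ 2 = (w * v ^+ 2) *: (Kmon a b * k * N).
  rewrite expr2 mulrA yx -scalerAl (kx _ _ (qcommMl cv cw)) scalerA /N expr2 -[E2 * E1 * E1]mulrA.
  by congr (_ *: _); ring.
have e2 : M = E3 * E1 + s *: N.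
  by rewrite /M E1E2 mulrDl -scalerAl /N expr2 mulrA addrC.
have e1 : E1 ^+ 2 * E2 = (r + s) *: (E3 * E1) + s ^+ 2 *: N.
  have -> : E1 ^+ 2 * E2 = (r + s) *: M - (r * s) *: N.
    by apply/eqP; rewrite -subr_eq0 opprB [X in _ + X]addrC addrA; apply/eqP.
  by rewrite e2 scalerDr scalerA -addrA -scalerBl; congr (_ + _ *: _); ring.
have kSxy : w *: (Kmon a b * k * (((r + s) * (u * (u - v))) *: (E3 * E1) +
    (s * (s * u ^+ 2 - (r + s) * (u * v) + r * v ^+ 2)) *: N)) = 0.
  rewrite -Sxy /serre t1 t2 t3 e1 e2; move: (E3 * E1) (Kmon a b * k) => M' k'.
  rewrite !mulrDr -!scalerAr !scalerDr !scalerA opprD addrACA -!scalerBl.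
  by rewrite -[RHS]addrA -scalerDl; congr (_ *: _ + _ *: _); ring.
have k0 : Kmon a b * k != 0.
  rewrite /k !KmonM; have := pbw_neq0 ((a + (a + c), b + (b + d)), (0, 0, 0)%N).
  by rewrite /pbw !expr0 !mulr1.
have w0 : w != 0 by rewrite invr_eq0.
move/eqP: kSxy; rewrite scaler_eq0 (negbTE w0) /= => /eqP/Uge0_domain.
case=> [kk0|]; first by rewrite kk0 eqxx in k0.
have -> : E3 * E1 = pbw ((0, 0), (0, 1, 1)%N) by rewrite /pbw Kmon00 !mul1r !expr1.
have -> : N = pbw ((0, 0), (1, 0, 2)%N) by rewrite /pbw Kmon00 mul1r expr1 expr0 mulr1.
rewrite -!pbw_sumU -raddfD => /pbw_free.
move/(congr1 (mcoeff ((0, 0), (0, 1, 1)%N))); rewrite mcoeffD !mcoeffU mcoeff0.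
rewrite eqxx /= addr0 => /eqP; rewrite !mulf_eq0 (negbTE rDs) /= invr_eq0 (negbTE (wn0 _ _ _ _)) /=.
by rewrite subr_eq0 => /eqP/invr_inj/pw_inj[]; exact: weight_symmetric.
Qed.

End Endomorphism.

(** theta (phi E1) = E1 reads theta g1 * f1 * E1 = E1, so f1 has a left inverse. *)
Lemma automorphism_form (theta : {lrmorphism V -> V}) : bijective theta ->
  exists (a1 a2 b1 b2 : F) (a b c d : int),
    [/\ a1 != 0, a2 != 0, b1 != 0 & b2 != 0] /\
    [/\ theta K1 = a1 *: K1,
        theta K2 = a2 *: K2,
        theta E1 = b1 *: (Kmon a b * E1) &
        theta E2 = b2 *: (Kmon c d * E2)] /\
    b = c /\ a + b + d = 0.
Proof.
case=> g thetaK gK.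
pose phi : {lrmorphism V -> V} := HB.pack g
  (GRing.isZmodMorphism.Build V V g (can2_zmod_morphism thetaK gK))
  (GRing.isMonoidMorphism.Build V V g (can2_monoid_morphism thetaK gK))
  (GRing.isScalable.Build F V V *:%R g (can2_scalable thetaK gK)).
have phi_inj : injective phi := can_inj gK.
have [a1 [a2 [f1 [f2 [[a10 a20 tK1] [tK2 tE1 tE2]]]]]] := theta_diagonal (can_inj thetaK).
have [_ [_ [g1 [g2 [_ [_ pE1 pE2]]]]]] := theta_diagonal phi_inj.
have unit f h x : theta x = f * x -> phi x = h * x -> x != 0 -> theta h * f = 1.
  move=> tx px x0; apply: (Uge0_mulIr x0).
  by rewrite mul1r -mulrA -tx -[theta h * _]rmorphM -px; exact: gK.
have [b1 [a [b [b10 f1E]]]] :=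
  Uge0_right_inverse (unit _ _ _ tE1 pE1 E1_neq0).
have [b2 [c [d [b20 f2E]]]] :=
  Uge0_right_inverse (unit _ _ _ tE2 pE2 E2_neq0).
rewrite f1E -scalerAl in tE1; rewrite f2E -scalerAl in tE2.
exists a1, a2, b1, b2, a, b, c, d; split=> //; split=> //.
exact: theta_serre b10 b20 tE1 tE2.
Qed.

End Borel.

Theorem theorem2p1 (R : realType) (r s r3 s3 : R[i])
    (hr : r != 0) (hs : s != 0)
    (hrs : forall m n : int, r ^ m * s ^ n = 1 -> m = 0 /\ n = 0)
    (hr3 : r3 ^+ 3 = r) (hs3 : s3 ^+ 3 = s)
    (theta : {lrmorphism Uge0 r s r3 s3 -> Uge0 r s r3 s3})
    (htheta : bijective theta) :
  let E1 := UE1 r s r3 s3 in let E2 := UE2 r s r3 s3 in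
  let K1 := UK1 r s r3 s3 in let K2 := UK2 r s r3 s3 in
  exists (a1 a2 b1 b2 : R[i]) (a b c d : int),
    [/\ a1 != 0, a2 != 0, b1 != 0 & b2 != 0] /\
    [/\ theta K1 = a1 *: K1,
        theta K2 = a2 *: K2,
        theta E1 = b1 *: (K1 ^ a * K2 ^ b * E1) &
        theta E2 = b2 *: (K1 ^ c * K2 ^ d * E2)] /\
    b = c /\ a + b + d = 0.
Proof.
move=> E1 E2 K1 K2.
have r30 : r3 != 0 by apply: contraNneq hr => r30; rewrite -hr3 r30 expr0n.
have s30 : s3 != 0 by apply: contraNneq hs => s30; rewrite -hs3 s30 expr0n.
have indep (a b : int) : pw r3 s3 a b = 1 -> a = 0 /\ b = 0.
  move=> /(congr1 (fun x => x ^+ 3)); rewrite expr1n /pw exprMn.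
  have cube (x : R[i]) (n : int) : (x ^ n) ^+ 3 = (x ^+ 3) ^ n.
    by rewrite -[_ ^+ 3]/(_ ^ 3%:Z) -[x ^+ 3]/(x ^ 3%:Z) !exprz_exp mulrC.
  by rewrite !cube hr3 hs3; exact: hrs.
have [a1 [a2 [b1 [b2 [a [b [c [d [nz [[tK1 tK2 tE1 tE2] abcd]]]]]]]]]] :=
  automorphism_form r30 s30 hr3 hs3 indep htheta.
exists a1, a2, b1, b2, a, b, c, d; split=> //; split=> //.
by rewrite -!KmonE.
Qed.
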